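(* Let $N\geq 2$ and $s\in(0,1]$. Then (i) for any $m\in\mathbb{N}$, $\mathcal{H}_m^s(\mathbb{R}^N)=\mathcal{H}_m^1(\mathbb{R}^N)$; (ii) $\mathcal{H}^1(\mathbb{R}^N)\subset\mathcal{H}^s(\mathbb{R}^N)$.
   Context: Let $N\in\mathbb{N}$ and $s\in(0,1)$ with $N>2s$. The fractional Laplacian is defined by $(-\Delta)^s u(x)=\lim_{\epsilon\to0^+}c_{N,s}\int_{B_{1/\epsilon}\setminus B_\epsilon}\frac{u(x)-u(x+z)}{|z|^{N+2s}}\,dz$, i.e. in the principal value sense both at the origin and at infinity, where $B_r$ is the ball of radius $r$ centered at $0$ and $c_{N,s}=2^{2s}\pi^{-N/2}s\,\Gamma(\frac{N+2s}{2})/\Gamma(1-s)>0$. For $s=1$, $(-\Delta)^1$ denotes the classical operator $-\Delta$. Here $\mathbb{N}$ is the set of nonnegative integers. For $k\in\mathbb{N}$, $\mathbb{P}_k(\mathbb{R}^N)=\{\sum_{|\alpha|=k}b_\alpha x^\alpha:\ \alpha\in\mathbb{N}^N,\ b_\alpha\in\mathbb{R}\}$ is the set of homogeneous polynomials of order $k$, with $x^\alpha=\prod_{i=1}^N x_i^{\alpha_i}$. For $s\in(0,1]$, $\mathcal{H}^s(\mathbb{R}^N)$ denotes the set of all $s$-harmonic functions in $\mathbb{R}^N$, i.e. classical solutions of $(-\Delta)^s u=0$ in $\mathbb{R}^N$, and $\mathcal{H}_m^s(\mathbb{R}^N)=\{u\in\mathbb{P}_m(\mathbb{R}^N):\ u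 \text{ is } s\text{-harmonic in } \mathbb{R}^N\}$. In particular $\mathcal{H}_m^1(\mathbb{R}^N)$ is the set of harmonic homogeneous polynomials of order $m$ and $\mathcal{H}^1(\mathbb{R}^N)$ is the set of harmonic functions in $\mathbb{R}^N$. *)

(* Defs.v *)
From HB Require Import structures.
From mathcomp Require Import all_boot all_order all_algebra.
From mathcomp Require Import all_classical all_reals all_analysis.
Unset Printing Implicit Defensive.
Import Order.TTheory GRing.Theory Num.Theory.
Import numFieldNormedType.Exports.
Local Open Scope classical_set_scope.
Local Open Scope ring_scope.

Section Defs.
Variable R : realType.

(* Euclidean norm on R^N (the library norm on matrices is the sup norm). *)
Definition enorm (N : nat) (x : 'rV[R]_N) : R := Num.sqrt (\sum_(i < N) x ord0 i ^+ 2).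

Fixpoint iint (n : nat) : (n.-tuple R -> R) -> R :=
  match n return (n.-tuple R -> R) -> R with
  | 0 => fun f => f [tuple]
  | n'.+1 => fun f =>
      Rintegral (@lebesgue_measure R) setT
        (fun t : R => iint n' (fun v : n'.-tuple R => f (cons_tuple t v)))
  end.

Definition rint (N : nat) (g : 'rV[R]_N -> R) : R :=
  iint N (fun t : N.-tuple R => g (\row_(i < N) tnth t i)).

Definition Gamma (z : R) : R :=
  Rintegral (@lebesgue_measure R) [set t : R | 0 < t]
    (fun t => powR t (z - 1) * expR (- t)).

Definition cNs (N : nat) (s : R) : R :=
  2 `^ (2 * s) * powR pi (- (N%:R / 2)) * s
  * Gamma ((N%:R + 2 * s) / 2) / Gamma (1 - s).

Definition frac_lap_trunc (N : nat) (s : R) (u : 'rV[R]_N -> R)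
    (x : 'rV[R]_N) (eps : R) : R :=
  cNs N s * rint N (fun z : 'rV[R]_N =>
    if (eps <= enorm N z) && (enorm N z < eps^-1)
    then (u x - u (x + z)) / (enorm N z `^ (N%:R + 2 * s)) else 0).

Definition evec (N : nat) (i : 'I_N) : 'rV[R]_N := delta_mx ord0 i.
Definition partial (N : nat) (i : 'I_N) (f : 'rV[R]_N -> R) : 'rV[R]_N -> R :=
  fun x => 'D_(evec N i) f x.

Definition harmonic (N : nat) (u : 'rV[R]_N -> R) : Prop :=
  (forall x : 'rV[R]_N, differentiable u x) /\
  (forall (i : 'I_N) (x : 'rV[R]_N), differentiable (partial N i u) x) /\
  (forall i j : 'I_N, continuous (partial N j (partial N i u))) /\
  (forall x : 'rV[R]_N, \sum_(i < N) partial N i (partial N i u) x = 0).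

Definition s_harmonic (N : nat) (s : R) (u : 'rV[R]_N -> R) : Prop :=
  if s < 1 then
    continuous u /\
    forall x : 'rV[R]_N, frac_lap_trunc N s u x eps @[eps --> 0^'+] --> 0
  else harmonic N u.

Definition hom_poly (N k : nat) : set ('rV[R]_N -> R) :=
  [set p | exists b : {ffun 'I_N -> 'I_k.+1} -> R,
     p = fun x : 'rV[R]_N => \sum_(a : {ffun 'I_N -> 'I_k.+1} | (\sum_(i < N) (a i : nat) == k)%N)
                    b a * \prod_(i < N) x ord0 i ^+ a i].

Definition Hs (N : nat) (s : R) : set ('rV[R]_N -> R) := [set u | s_harmonic N s u].
Definition Hsm (N : nat) (s : R) (m : nat) : set ('rV[R]_N -> R) :=
  hom_poly N m `&` [set u | s_harmonic N s u].

End Defs.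

Arguments hom_poly {R}.
Arguments s_harmonic {R}.
Arguments harmonic {R}.
Arguments Hs {R}.
Arguments Hsm {R}.
Arguments frac_lap_trunc {R}.
Arguments rint {R}.
Arguments enorm {R}.
Arguments cNs {R}.
Arguments Gamma {R}.
Arguments partial {R}.
Arguments evec {R}.
Arguments iint {R}.

(* Main.v *)
(* Let u be C^2 and g a continuous function on R vanishing on [B, +oo[, with primitive G also
   vanishing there. Integrating by parts in each coordinate,
     d/dr \int u(x + r z) g(|z|^2) dz = - r \int (Laplacian u)(x + r z) G(|z|^2) / 2 dz,
   so for harmonic u this radial mean does not depend on r: no polar coordinates are needed.
   Approximating the weight |z|^-(N+2s) on the annulus eps <= |z| < 1/eps by such g(|z|^2), the
   truncated fractional Laplacian of a harmonic function is exactly 0 for each eps.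
   Conversely, for a homogeneous polynomial p, write p(x + t z) = \sum_k t^k p_k(z). The truncated
   integral of p at x / m is, up to the factor -m^-(deg p), a polynomial in m without constant
   term whose coefficients c_k are c_{N,s} times the integrals of p_k against the weight; if it
   tends to 0 for all m > 0 then so does each c_k. By the identity above c_2 is a multiple of
   Laplacian p (x) by a factor bounded away from 0 as eps -> 0, hence Laplacian p = 0. *)
Require Import Defs.
From HB Require Import structures.
From mathcomp Require Import all_boot all_order all_algebra.
From mathcomp Require Import all_classical all_reals all_analysis.
From mathcomp Require Import measurable_realfun ring lra.
Import Order.TTheory GRing.Theory Num.Theory.
Import numFieldNormedType.Exports.
Set Implicit Arguments.
Unset Strict Implicit.
Unset Printing Implicit Defensive.
Local Open Scope classical_set_scope.
Local Open Scope ring_scope.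

(** * Iterated integrals of dominated functions *)

Section IteratedIntegral.
Variable R : realType.
Local Notation mu := (@lebesgue_measure R).

(** The main obstacle is the integral itself. [rint] iterates one-variable integrals that take
    conventional values on bad integrands, so measurability and integrability of every partial
    integral must be carried along. The proof confines itself to bounded integrands supported in a
    box that are continuous or pointwise limits of continuous ones; the limits are needed because
    the annulus weight jumps. For this class dominated convergence, linearity and positivity go
    through by induction on the dimension. Integration by parts is then obtained from translation
    invariance: the integral of h(z + t e_i) does not depend on t, so the integral of its derivative
    vanishes.

    Two points of the converse cost extra work. Dividing by c_{N,s} requires the Gamma integrals to
    be finite as well as positive, since a divergent real-valued integral is 0 by convention. And
    the lower bound on the second coefficient must be uniform in eps: it comes from one fixed tent
    function lying below the weights of all annuli with eps <= 1/2, compared at the level of the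
    primitives. *)

Definition vcons n (t : R) (v : 'rV[R]_n) : 'rV[R]_n.+1 :=
  \row_i (if unlift ord0 i is Some j then v ord0 j else t).

Definition vtail n (v : 'rV[R]_n.+1) : 'rV[R]_n := \row_i v ord0 (lift ord0 i).

Lemma vcons0 n t (v : 'rV[R]_n) : vcons t v ord0 ord0 = t.
Proof. by rewrite mxE unlift_none. Qed.

Lemma vconsS n t (v : 'rV[R]_n) i : vcons t v ord0 (lift ord0 i) = v ord0 i.
Proof. by rewrite mxE liftK. Qed.

Lemma vcons_eta n (v : 'rV[R]_n.+1) : vcons (v ord0 ord0) (vtail v) = v.
Proof.
by apply/rowP => i; rewrite mxE; case: unliftP => [j|] ->; rewrite ?mxE.
Qed.

Lemma vconsD n t (v : 'rV[R]_n) (a : 'rV[R]_n.+1) :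
  vcons t v + a = vcons (t + a ord0 ord0) (v + vtail a).
Proof.
apply/rowP => i; rewrite !mxE.
by case: unliftP => [j|] ->; rewrite ?mxE.
Qed.

Lemma rint0 (g : 'rV[R]_0 -> R) : rint 0 g = g 0.
Proof. by rewrite /rint /=; congr g; apply/rowP => -[]. Qed.

Lemma rintS n (g : 'rV[R]_n.+1 -> R) :
  rint n.+1 g = Rintegral mu setT (fun t => rint n (fun v => g (vcons t v))).
Proof.
rewrite /rint /=; congr Rintegral; apply/funext => t; congr iint.
apply/funext => w; congr g; apply/rowP => i; rewrite !mxE.
by case: unliftP => [j|] ->; rewrite ?mxE ?tnthS.
Qed.

Definition box n (M : R) (v : 'rV[R]_n) := [forall i, `|v ord0 i| <= M].

Lemma box_cons n M t (v : 'rV[R]_n) : box M (vcons t v) = (`|t| <= M) && box M v.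
Proof.
apply/forallP/andP => [h|[h0 /forallP h] i].
  split; first by have := h ord0; rewrite vcons0.
  by apply/forallP => i; have := h (lift ord0 i); rewrite vconsS.
by rewrite mxE; case: unliftP => [j|] _.
Qed.

Lemma box0 n (M : R) : 0 <= M -> box M (0 : 'rV[R]_n).
Proof. by move=> M0; apply/forallP => i; rewrite mxE normr0. Qed.

(** One inequality encodes both the bound and the support. The indicator of a box is a product over
    the coordinates, so a slice is dominated again, with a constant that is itself an integrable
    function of the fixed coordinate; this is what makes inductions on n work. *)
Definition dominated n (M K : R) (f : 'rV[R]_n -> R) :=
  forall v, `|f v| <= K * (box M v)%:R.

Lemma dominated_ge0 n M K (f : 'rV[R]_n -> R) : 0 <= M -> dominated M K f -> 0 <= K.
Proof. by move=> M0 /(_ 0); rewrite box0// mulr1; exact: le_trans. Qed.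

Lemma dominatedS n M K (f : 'rV[R]_n.+1 -> R) (t : R) : dominated M K f ->
  dominated M (K * (`|t| <= M)%R%:R) (fun v => f (vcons t v)).
Proof.
move=> h v; have := h (vcons t v); rewrite box_cons -mulrA -natrM mulnb.
by case: (_ <= M).
Qed.

(** This follows the recursion of [iint]: exactly the one-variable functions that get integrated are
    required to be measurable. The property passes to dominated limits without any appeal to product
    measures. *)
Fixpoint iter_measurable n : ('rV[R]_n -> R) -> Prop :=
  match n with
  | 0 => fun _ => True
  | n'.+1 => fun f => (forall t, iter_measurable (fun v => f (vcons t v))) /\
      measurable_fun setT (fun t => rint n' (fun v => f (vcons t v)))
  end.

Lemma integrable_box (M K : R) (f : R -> R) : measurable_fun setT f ->
  (forall t, `|f t| <= K * (`|t| <= M)%R%:R) -> mu.-integrable setT (EFin \o f).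
Proof.
move=> mf fK.
have iK : mu.-integrable setT (EFin \o (fun t => K * \1_`[- M, M]%classic t)).
  rewrite (_ : _ \o _ = (fun t => (K%:E * (\1_`[- M, M]%classic t)%:E)%E)); last first.
    by apply/funext => t /=; rewrite EFinM.
  by apply: integrableZl => //; exact: integrable_indic_itv.
apply: (le_integrable _ _ _ iK) => //; first exact/measurable_EFinP.
move=> t _ /=; rewrite lee_fin (le_trans (fK t))// indicE mem_setE in_itv/= -ler_norml.
exact: ler_norm.
Qed.

Lemma Rintegral_cst_box (M K : R) : 0 <= M ->
  Rintegral mu setT (fun t => K * (`|t| <= M)%R%:R) = 2 * M * K.
Proof.
move=> M0.
rewrite (_ : (fun _ => _) = (cst K \_ `[- M, M]%classic)); last first.
  apply/funext => t; rewrite patchE mem_setE in_itv/= -ler_norml.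
  by case: ifP => _; rewrite ?mulr1 ?mulr0.
rewrite -Rintegral_mkcond Rintegral_cst//=.
rewrite lebesgue_measure_itv/= lte_fin; case: ltP => h.
  by rewrite -EFinB /=; ring.
have -> : M = 0 by apply/eqP; rewrite eq_le M0 andbT; lra.
by rewrite /= !mulr0 mul0r.
Qed.

Lemma le_norm_Rintegral_box (M K : R) (f : R -> R) : 0 <= M -> measurable_fun setT f ->
  (forall t, `|f t| <= K * (`|t| <= M)%R%:R) -> `|Rintegral mu setT f| <= 2 * M * K.
Proof.
move=> M0 mf fK; rewrite -Rintegral_cst_box//.
apply: le_trans (le_normr_Rintegral _ (integrable_box mf fK)) _ => //.
apply: le_Rintegral => //.
- apply: (@integrable_box M K); last by move=> t; rewrite normr_id.
  exact: measurableT_comp.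
- apply: (@integrable_box M K).
    apply: measurable_funM => //.
    rewrite (_ : (fun _ => _) = (\1_(`[- M, M]%classic) : R -> R)).
      exact: measurable_indic.
    by apply/funext => t; rewrite indicE mem_setE in_itv/= -ler_norml.
  move=> t; rewrite normrM [X in _ * X]ger0_norm//.
  have K0 : 0 <= K.
    by have := fK 0; rewrite normr0 M0 mulr1; exact: le_trans.
  by rewrite (ger0_norm K0).
Qed.

(** Measurability of the limit is part of the conclusion because the induction in [cvg_rint] has to
    return [iter_measurable] for the limit function. *)
Lemma cvg_Rintegral_box (M K : R) (f_ : nat -> R -> R) (f : R -> R) :
  (forall k, measurable_fun setT (f_ k)) ->
  (forall k t, `|f_ k t| <= K * (`|t| <= M)%R%:R) ->
  (forall t, f_ ^~ t @ \oo --> f t) ->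
  measurable_fun setT f /\ Rintegral mu setT (f_ k) @[k --> \oo] --> Rintegral mu setT f.
Proof.
move=> mf fK ff.
have mfoo : measurable_fun setT f.
  by apply: (measurable_fun_cvg (h := f_)) => // t _; exact: ff.
split=> //.
have iK : mu.-integrable setT (EFin \o (fun t => K * (`|t| <= M)%R%:R)).
  apply: (@integrable_box M K).
    apply: measurable_funM => //.
    rewrite (_ : (fun _ => _) = (\1_(`[- M, M]%classic) : R -> R)).
      exact: measurable_indic.
    by apply/funext => t; rewrite indicE mem_setE in_itv/= -ler_norml.
  move=> t; rewrite ger0_norm//.
  by apply: le_trans (fK 0%N t); rewrite normr_ge0.
have [||||iF _] := @dominated_convergence _ _ _ mu setT measurableT
  (fun k => EFin \o f_ k) (EFin \o f) _ _ _ _ iK.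
- by move=> k; apply/measurable_EFinP; exact: mf.
- by apply/measurable_EFinP; exact: mfoo.
- by apply: aeW => t _; apply: cvg_EFin; [exact: nearW | exact: ff].
- by apply: aeW => t k _; rewrite /= lee_fin; exact: fK.
move=> /=; rewrite /Rintegral.
have -> : (\int[mu]_x (EFin \o f) x)%E = (fine (\int[mu]_x (EFin \o f) x))%:E.
  by rewrite fineK//; exact: integrable_fin_num.
by move=> /fine_cvgP[_].
Qed.

Lemma rint_le n (M K : R) (f : 'rV[R]_n -> R) : 0 <= M -> iter_measurable f ->
  dominated M K f -> `|rint n f| <= (2 * M) ^+ n * K.
Proof.
move=> M0; elim: n K f => [|n IH] K f.
  by move=> _ /(_ 0); rewrite rint0 expr0 mul1r box0// mulr1.
move=> [okf mf] domf; rewrite rintS exprS -mulrA.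
apply: le_norm_Rintegral_box => // t.
rewrite -mulrA; apply: IH; first exact: okf.
exact: dominatedS.
Qed.

(** Dominated convergence, one coordinate at a time: the partial integrals converge pointwise by
    induction, and [rint_le] bounds them by (2M)^n K on [-M, M], which is the domination needed for
    the outer integral. *)
Lemma cvg_rint n (M K : R) (f_ : nat -> 'rV[R]_n -> R) (f : 'rV[R]_n -> R) : 0 <= M ->
  (forall k, iter_measurable (f_ k)) -> (forall k, dominated M K (f_ k)) ->
  (forall v, f_ ^~ v @ \oo --> f v) ->
  iter_measurable f /\ rint n (f_ k) @[k --> \oo] --> rint n f.
Proof.
move=> M0; elim: n K f_ f => [|n IH] K f_ f okf domf ff.
  by split=> //; rewrite rint0; under eq_fun do rewrite rint0; exact: ff.
have H t := IH _ (fun k v => f_ k (vcons t v)) (fun v => f (vcons t v))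
  (fun k => (okf k).1 t) (fun k => dominatedS t (domf k)) (fun v => ff (vcons t v)).
rewrite rintS; under eq_fun do rewrite rintS.
have [] := @cvg_Rintegral_box M ((2 * M) ^+ n * K)
  (fun k t => rint n (fun v => f_ k (vcons t v))) (fun t => rint n (fun v => f (vcons t v))).
- by move=> k; exact: (okf k).2.
- move=> k t; rewrite -mulrA; apply: rint_le => //; first exact: (okf k).1.
  exact: dominatedS.
- by move=> t; exact: (H t).2.
by move=> mf cf; split => //; split => // t; exact: (H t).1.
Qed.

Lemma dominatedDZ n M K L c (f g : 'rV[R]_n -> R) : dominated M K f -> dominated M L g ->
  dominated M (K + `|c| * L) (fun v => f v + c * g v).
Proof.
move=> fK gL v; rewrite mulrDl (le_trans (ler_normD _ _))// lerD// normrM -mulrA.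
by rewrite ler_wpM2l.
Qed.

Lemma rintDZ n M K L c (f g : 'rV[R]_n -> R) : 0 <= M ->
  iter_measurable f -> dominated M K f -> iter_measurable g -> dominated M L g ->
  iter_measurable (fun v => f v + c * g v) /\
  rint n (fun v => f v + c * g v) = rint n f + c * rint n g.
Proof.
move=> M0; elim: n K L f g => [|n IH] K L f g okf fK okg gL.
  by rewrite !rint0.
have H t := IH _ _ _ _ (okf.1 t) (dominatedS t fK) (okg.1 t) (dominatedS t gL).
have If : mu.-integrable setT (EFin \o (fun t => rint n (fun v => f (vcons t v)))).
  apply: (@integrable_box M ((2 * M) ^+ n * K)); first exact: okf.2.
  by move=> t; rewrite -mulrA; apply: rint_le => //; [exact: okf.1|exact: dominatedS].
have Ig : mu.-integrable setT (EFin \o (fun t => rint n (fun v => g (vcons t v)))).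
  apply: (@integrable_box M ((2 * M) ^+ n * L)); first exact: okg.2.
  by move=> t; rewrite -mulrA; apply: rint_le => //; [exact: okg.1|exact: dominatedS].
have E : (fun t => rint n (fun v => f (vcons t v) + c * g (vcons t v))) =
  (fun t => rint n (fun v => f (vcons t v)) + c * rint n (fun v => g (vcons t v))).
  by apply/funext => t; exact: (H t).2.
split.
  split=> [t|]; first exact: (H t).1.
  rewrite E; apply: measurable_funD; first exact: okf.2.
  by apply: measurable_funM => //; exact: okg.2.
rewrite !rintS E RintegralD//; first by rewrite RintegralZl.
rewrite (_ : _ \o _ = (fun t => c%:E * (rint n (fun v => g (vcons t v)))%:E)%E).
  exact: integrableZl.
by apply/funext => t /=; rewrite EFinM.
Qed.

Lemma le_rint n M K L (f g : 'rV[R]_n -> R) : 0 <= M ->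
  iter_measurable f -> dominated M K f -> iter_measurable g -> dominated M L g ->
  (forall v, f v <= g v) -> rint n f <= rint n g.
Proof.
move=> M0; elim: n K L f g => [|n IH] K L f g okf fK okg gL fg.
  by rewrite !rint0.
rewrite !rintS; apply: le_Rintegral => //.
- apply: (@integrable_box M ((2 * M) ^+ n * K)); first exact: okf.2.
  by move=> t; rewrite -mulrA; apply: rint_le => //; [exact: okf.1|exact: dominatedS].
- apply: (@integrable_box M ((2 * M) ^+ n * L)); first exact: okg.2.
  by move=> t; rewrite -mulrA; apply: rint_le => //; [exact: okg.1|exact: dominatedS].
move=> t _.
by apply: (IH _ _ _ _ (okf.1 t) (dominatedS t fK) (okg.1 t) (dominatedS t gL)).
Qed.

End IteratedIntegral.

(** * Continuous integrands and their dominated limits *)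

Section ContinuousFunctions.
Variable R : realType.

Lemma cvg_rV (T : Type) (F : set_system T) (FF : Filter F) n (g : T -> 'rV[R]_n) (v : 'rV[R]_n) :
  (forall i, g x ord0 i @[x --> F] --> v ord0 i) -> g x @[x --> F] --> v.
Proof.
move=> h A [P vP sPA]; rewrite /nbhs /=.
apply: (filterS (P := fun x => forall i, P ord0 i (g x ord0 i))).
  by move=> x Px; apply: sPA => i j; rewrite ord1.
by apply: filter_forall => i; exact: (h i _ (vP ord0 i)).
Qed.

Lemma cvg_vcons (T : Type) (F : set_system T) (FF : Filter F) n (a : T -> R)
    (g : T -> 'rV[R]_n) (t : R) (v : 'rV[R]_n) :
  a x @[x --> F] --> t -> g x @[x --> F] --> v ->
  vcons (a x) (g x) @[x --> F] --> vcons t v.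
Proof.
move=> ha hg; apply: cvg_rV => i; rewrite mxE.
under eq_fun do rewrite mxE.
case: unliftP => [j|] _ //.
exact: (cvg_comp _ _ hg (@coord_continuous _ _ _ ord0 j v)).
Qed.

Lemma continuous_slice n (f : 'rV[R]_n.+1 -> R) t :
  continuous f -> continuous (fun v => f (vcons t v)).
Proof.
move=> cf v; apply: continuous_comp; last exact: cf.
exact: (@cvg_vcons _ (nbhs v) _ n (cst t) id t v (cvg_cst _) cvg_id).
Qed.

(** Measurability of a partial integral comes from its continuity, which is [cvg_rint] applied to
    slices along a sequence. The continuity is also exported, under a match since it needs a first
    coordinate, for use in [rint_translation] and [rint_gt0]. *)
Lemma iter_measurable_continuous n (M K : R) (f : 'rV[R]_n -> R) : 0 <= M ->
  continuous f -> dominated M K f -> iter_measurable f /\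
  (if n is n'.+1 return ('rV[R]_n -> R) -> Prop
   then fun f => continuous (fun t => rint n' (fun v => f (vcons t v))) else fun=> True) f.
Proof.
move=> M0; elim: n K f => [|n IH] K f cf fK //.
have H t : iter_measurable (fun v => f (vcons t v)).
  apply: (IH (K * (`|t| <= M)%R%:R) _ _ _).1; last exact: dominatedS.
  exact: continuous_slice.
suff C : continuous (fun t => rint n (fun v => f (vcons t v))).
  by split=> //; split=> //; exact: continuous_measurable_fun.
move=> t; apply/continuous_withinNx/cvgr_dnbhsP => u [_ ut].
apply: (@cvg_rint _ _ M K (fun k v => f (vcons (u k) v)) _ M0 _ _ _).2.
- by move=> k; exact: H.
- move=> k v; apply: le_trans (dominatedS (u k) fK v) _.
  rewrite ler_wpM2r//.
  have K0 := dominated_ge0 M0 fK.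
  by case: (_ <= M); rewrite ?mulr1 ?mulr0.
- move=> v; apply: (cvg_comp (fun k => vcons (u k) v) f); last exact: cf.
  by apply: cvg_vcons => //; exact: cvg_cst.
Qed.

Definition compactly_dominated n (f : 'rV[R]_n -> R) :=
  exists M K, [/\ 0 <= M & dominated M K f].

(** The class of integrands used from here on. It is wider than the compactly supported continuous
    functions so as to contain products with the discontinuous annulus weight. *)
Definition tame n (f : 'rV[R]_n -> R) := compactly_dominated f /\ iter_measurable f.

Lemma dominated_weaken n (M M' K K' : R) (f : 'rV[R]_n -> R) : 0 <= M -> M <= M' -> K <= K' ->
  dominated M K f -> dominated M' K' f.
Proof.
move=> M0 MM KK fK v; have K0 := dominated_ge0 M0 fK.
apply: le_trans (fK v) _; apply: ler_pM => //.
rewrite ler_nat; case: (boolP (box M v)) => // /forallP h.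
suff -> : box M' v by [].
by apply/forallP => i; exact: le_trans (h i) MM.
Qed.

Lemma tame_continuous n (f : 'rV[R]_n -> R) : continuous f -> compactly_dominated f -> tame f.
Proof.
move=> cf [M [K [M0 fK]]]; split; first by exists M, K.
exact: (iter_measurable_continuous M0 cf fK).1.
Qed.

Lemma common_bound n (f g : 'rV[R]_n -> R) : compactly_dominated f -> compactly_dominated g ->
  exists M K, [/\ 0 <= M, dominated M K f & dominated M K g].
Proof.
move=> [M [K [M0 fK]]] [M' [K' [M0' gK]]].
exists (Num.max M M'), (Num.max K K'); split; first by rewrite le_max M0.
  by apply: dominated_weaken fK; rewrite ?le_max ?lexx.
by apply: dominated_weaken gK; rewrite ?le_max ?lexx ?orbT.
Qed.

Lemma tameDZ n c (f g : 'rV[R]_n -> R) : tame f -> tame g ->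
  tame (fun v => f v + c * g v) /\ rint n (fun v => f v + c * g v) = rint n f + c * rint n g.
Proof.
move=> [/common_bound + mf] [bg mg] => /(_ _ bg)[M [K [M0 fK gK]]].
have [H1 H2] := rintDZ c M0 mf fK mg gK; split=> //; split=> //.
exists M, (K + `|c| * K); split=> //; exact: dominatedDZ.
Qed.

Lemma tame_le n (f g : 'rV[R]_n -> R) : tame f -> tame g -> (forall v, f v <= g v) ->
  rint n f <= rint n g.
Proof.
move=> [/common_bound + mf] [bg mg] => /(_ _ bg)[M [K [M0 fK gK]]].
by move=> fg; exact: (le_rint M0 mf fK mg gK fg).
Qed.

Lemma tame0 n : tame (fun _ : 'rV[R]_n => 0) /\ rint n (fun _ : 'rV[R]_n => 0 : R) = 0.
Proof.
have T0 : tame (fun _ : 'rV[R]_n => 0 : R).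
  apply: tame_continuous; first exact: cst_continuous.
  by exists 0, 0; split=> // v; rewrite normr0 mul0r.
(* Additivity gives I = I + I for the integral I of the zero function. *)
split=> //; have [_] := tameDZ 1 T0 T0.
under eq_fun do rewrite mulr0 addr0.
by rewrite mul1r -[LHS]addr0 => /addrI.
Qed.

Lemma tameD n (f g : 'rV[R]_n -> R) : tame f -> tame g ->
  tame (fun v => f v + g v) /\ rint n (fun v => f v + g v) = rint n f + rint n g.
Proof.
move=> tf tg; have := tameDZ 1 tf tg; rewrite mul1r.
by under eq_fun do rewrite mul1r.
Qed.

Lemma tameZ n c (f : 'rV[R]_n -> R) : tame f ->
  tame (fun v => c * f v) /\ rint n (fun v => c * f v) = c * rint n f.
Proof.
move=> tf; have [t0 r0] := tame0 n; have := tameDZ c t0 tf; rewrite r0 add0r.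
by under eq_fun do rewrite add0r.
Qed.

Lemma tame_sum n I (r : seq I) (F : I -> 'rV[R]_n -> R) : (forall i, tame (F i)) ->
  tame (fun v => \sum_(i <- r) F i v) /\
  rint n (fun v => \sum_(i <- r) F i v) = \sum_(i <- r) rint n (F i).
Proof.
move=> tF; elim: r => [|i r [IH1 IH2]].
  rewrite big_nil; under eq_fun do rewrite big_nil; exact: tame0.
rewrite big_cons -IH2; under eq_fun do rewrite big_cons.
exact: tameD.
Qed.

Lemma tame_cvg n (M K : R) (f_ : nat -> 'rV[R]_n -> R) (f : 'rV[R]_n -> R) : 0 <= M ->
  (forall k, continuous (f_ k)) -> (forall k, dominated M K (f_ k)) ->
  (forall v, f_ ^~ v @ \oo --> f v) ->
  tame f /\ rint n (f_ k) @[k --> \oo] --> rint n f.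
Proof.
move=> M0 cf fK ff.
have [mf cvf] := cvg_rint M0 (fun k => (iter_measurable_continuous M0 (cf k) (fK k)).1) fK ff.
split=> //; split=> //; exists M, K; split=> // v.
have nf : `|f_ k v| @[k --> \oo] --> `|f v| by apply: cvg_norm; exact: ff.
apply: (cvgr_to_le nf).
by apply: nearW => k; exact: fK.
Qed.

End ContinuousFunctions.

(** * Translation and differentiation of iterated integrals *)

Section TranslationDifferentiation.
Variable R : realType.
Local Notation mu := (@lebesgue_measure R).

Lemma continuous_max_fun (T : topologicalType) (f g : T -> R) :
  continuous f -> continuous g -> continuous (fun x => Num.max (f x) (g x)).
Proof.
move=> cf cg.
have -> : (fun x => Num.max (f x) (g x)) = (fun x => (f x + g x + `|f x - g x|) / 2).
  by apply/funext => x; rewrite maxr_absE.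
move=> x; apply: cvgM; last exact: cvg_cst.
apply: cvgD; first by apply: cvgD; [exact: cf|exact: cg].
by apply: cvg_norm; apply: cvgB; [exact: cf|exact: cg].
Qed.

Lemma continuous_min_fun (T : topologicalType) (f g : T -> R) :
  continuous f -> continuous g -> continuous (fun x => Num.min (f x) (g x)).
Proof.
move=> cf cg.
have -> : (fun x => Num.min (f x) (g x)) = (fun x => (f x + g x - `|f x - g x|) / 2).
  by apply/funext => x; rewrite minr_absE.
move=> x; apply: cvgM; last exact: cvg_cst.
apply: cvgB; first by apply: cvgD; [exact: cf|exact: cg].
by apply: cvg_norm; apply: cvgB; [exact: cf|exact: cg].
Qed.

Lemma Rintegral_translation_ge0 (G : R -> R) a : continuous G -> (forall t, 0 <= G t) ->
  Rintegral mu setT (fun t => G (t + a)) = Rintegral mu setT G.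
Proof.
move=> cG G0; rewrite /Rintegral.
pose F := fun t : R => t + a.
have dF (t : R) : is_derive t 1 F 1.
  by rewrite -[X in is_derive _ _ _ X]addr0; apply: is_deriveD.
have dFE : derive1 F = cst 1.
  by apply/funext => t; rewrite derive1E; apply: derive_val.
rewrite (@increasing_ge0_integration_by_substitutionT _ F G) ?dFE//.
- by congr fine; apply: eq_integral => t _ /=; rewrite mulr1.
- by move=> x y xy; rewrite ltrD2r.
- by move=> t; exact: cvg_cst.
- exact: is_cvg_cst.
- exact: is_cvg_cst.
- apply/cvgrNyPle => A; near=> t; rewrite /F -lerBrDr; near: t.
  by apply: nbhs_ninfty_le; rewrite num_real.
- apply/cvgryPge => A; near=> t; rewrite /F -lerBlDr; near: t.
  by apply: nbhs_pinfty_ge; rewrite num_real.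
Unshelve. all: by end_near. Qed.

(** The substitution rule behind [Rintegral_translation_ge0] is for nonnegative integrands, so G is
    split into positive and negative parts, both dominated by |G|. *)
Lemma Rintegral_translation (M K : R) (G : R -> R) a : 0 <= M -> continuous G ->
  (forall t, `|G t| <= K * (`|t| <= M)%R%:R) ->
  Rintegral mu setT (fun t => G (t + a)) = Rintegral mu setT G.
Proof.
move=> M0 cG GK.
have K0 : 0 <= K.
  by have := GK 0; rewrite normr0 M0 mulr1; exact: le_trans.
pose P t := Num.max (G t) 0; pose Q t := Num.max (- G t) 0.
have cP : continuous P by apply: continuous_max_fun => // t; exact: cvg_cst.
have cQ : continuous Q.
  by apply: continuous_max_fun => t; [apply: cvgN; exact: cG|exact: cvg_cst].
have P0 t : 0 <= P t by rewrite le_max lexx orbT.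
have Q0 t : 0 <= Q t by rewrite le_max lexx orbT.
have GE t : G t = P t - Q t.
  by rewrite /P /Q; case: (leP (G t) 0); case: (leP (- G t) 0) => ? ?; lra.
have PG t : `|P t| <= `|G t|.
  by rewrite ger0_norm// /P ge_max normr_ge0 ler_norm.
have QG t : `|Q t| <= `|G t|.
  by rewrite ger0_norm// /Q ge_max normr_ge0 -normrN ler_norm.
have iPQ (H : R -> R) : continuous H -> (forall t, `|H t| <= `|G t|) ->
    mu.-integrable setT (EFin \o H) /\
    mu.-integrable setT (EFin \o (fun t => H (t + a))).
  move=> cH HG; split; first (apply: (@integrable_box _ M K)).
  - exact: continuous_measurable_fun.
  - by move=> t; exact: le_trans (HG t) (GK t).
  (* The translate is supported in the interval enlarged by |a|. *)
  apply: (@integrable_box _ (M + `|a|) K).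
    apply: continuous_measurable_fun => t; apply: continuous_comp; last exact: cH.
    by apply: cvgD; [exact: cvg_id|exact: cvg_cst].
  move=> t; apply: le_trans (HG _) _; apply: le_trans (GK _) _.
  case: (leP `|t + a| M) => h; last first.
    by rewrite mulr0 mulr_ge0.
  suff -> : `|t| <= M + `|a| by [].
  rewrite -[t](addrK a); apply: le_trans (ler_normB _ _) _.
  by rewrite lerD2r.
have [iP iPa] := iPQ _ cP PG; have [iQ iQa] := iPQ _ cQ QG.
under eq_Rintegral do rewrite GE.
rewrite RintegralB// !Rintegral_translation_ge0//.
under [in RHS]eq_Rintegral do rewrite GE.
by rewrite RintegralB.
Qed.

Lemma rint_translation n (f : 'rV[R]_n -> R) a : continuous f -> compactly_dominated f ->
  rint n (fun v => f (v + a)) = rint n f.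
Proof.
move=> + [M [K [M0]]]; elim: n K f a => [|n IH] K f a cf fK.
  by rewrite !rint0 add0r; congr f; apply/rowP => -[].
rewrite !rintS.
have [mf ctsf] := iter_measurable_continuous M0 cf fK.
transitivity (Rintegral mu setT (fun t => rint n (fun v => f (vcons (t + a ord0 ord0) v)))).
  congr Rintegral; apply/funext => t.
  under eq_fun do rewrite vconsD.
  exact: (IH _ (fun v => f (vcons (t + a ord0 ord0) v)) (vtail a)
    (@continuous_slice _ _ _ _ cf) (dominatedS _ fK)).
apply: (@Rintegral_translation M ((2 * M) ^+ n * K)
  (fun t => rint n (fun v => f (vcons t v)))) => // t.
by rewrite -mulrA; apply: rint_le => //; [exact: mf.1|exact: dominatedS].
Qed.

(** By induction the partial integral is positive at the first coordinate of v. Being continuous, it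
    exceeds half that value on a whole interval, and it is nonnegative elsewhere. *)
Lemma rint_gt0 n (f : 'rV[R]_n -> R) v : continuous f -> compactly_dominated f ->
  (forall w, 0 <= f w) -> 0 < f v -> 0 < rint n f.
Proof.
move=> + [M [K [M0]]]; elim: n K f v => [|n IH] K f v cf fK f0 fv.
  by rewrite rint0; suff -> : 0 = v by []; apply/rowP => -[].
have [mf ctsf] := iter_measurable_continuous M0 cf fK.
rewrite rintS; set g := (fun t => _) in ctsf *.
have g0 t : 0 <= g t.
  rewrite -[leLHS](@tame0 R n).2; apply: tame_le => //; first exact: (@tame0 R n).1.
  split; last exact: mf.1.
  by exists M, (K * (`|t| <= M)%R%:R); split=> //; exact: dominatedS.
have gv : 0 < g (v ord0 ord0).
  apply: (IH (K * (`|v ord0 ord0| <= M)%R%:R) _ (vtail v)) => //.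
  - exact: continuous_slice.
  - exact: dominatedS.
  - by rewrite vcons_eta.
have ig : mu.-integrable setT (EFin \o g).
  apply: (@integrable_box _ M ((2 * M) ^+ n * K)); first exact: mf.2.
  by move=> t; rewrite -mulrA; apply: rint_le => //; [exact: mf.1|exact: dominatedS].
set t0 := v ord0 ord0 in gv *; set c := g t0 / 2.
have c0 : 0 < c by rewrite divr_gt0.
have : \forall t \near t0, c < g t.
  have : g t @[t --> t0] --> g t0 by exact: ctsf.
  by move/cvgr_gt; apply; rewrite /c; lra.
move=> /nbhs_ballP[d /= d0 dg].
pose J := `[t0 - d / 2, t0 + d / 2]%classic.
have iJ : mu.-integrable setT (EFin \o (fun t => c * \1_J t)).
  rewrite (_ : _ \o _ = (fun t => c%:E * (\1_J t)%:E)%E); last first.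
    by apply/funext => t /=; rewrite EFinM.
  by apply: integrableZl => //; exact: integrable_indic_itv.
apply: (@lt_le_trans _ _ (Rintegral mu setT (fun t => c * \1_J t))); last first.
  apply: le_Rintegral => // t _.
  rewrite indicE; case: (boolP (t \in J)) => tJ; last by rewrite mulr0 g0.
  rewrite mulr1; apply/ltW/dg.
  move: tJ; rewrite mem_setE in_itv/= => /andP[h1 h2].
  by rewrite /ball/= ltr_norml; apply/andP; split; lra.
rewrite (_ : (fun _ => _) = cst c \_ J); last first.
  apply/funext => t; rewrite patchE indicE.
  by case: ifP => _; rewrite ?mulr1 ?mulr0.
rewrite -Rintegral_mkcond /J Rintegral_cst//= lebesgue_measure_itv/= lte_fin.
rewrite ifT; last lra.
by rewrite -EFinB/= mulr_gt0//; lra.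
Qed.

Lemma compact_box n (M : R) : compact [set v : 'rV[R]_n | box M v].
Proof.
have := @rV_compact _ n (fun=> `[- M, M]%classic) (fun=> @segment_compact _ _ _).
congr compact; apply/seteqP; split=> v /=.
  by move=> h; apply/forallP => i; have := h i; rewrite in_itv/= ler_norml.
by move=> /forallP h i; have := h i; rewrite in_itv/= ler_norml.
Qed.

Lemma continuous_bounded_box n (M : R) (f : 'rV[R]_n -> R) : continuous f ->
  exists K, 0 <= K /\ forall v, box M v -> `|f v| <= K.
Proof.
move=> cf.
have : compact (f @` [set v | box M v]).
  apply: continuous_compact; last exact: compact_box.
  exact: continuous_subspaceT.
move=> /compact_bounded[A [_ hA]].
exists (`|A| + 1); split; first by rewrite addr_ge0.
move=> v bv; apply: (hA (`|A| + 1)); last by exists v.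
by rewrite (le_lt_trans (ler_norm _))// ltrDl.
Qed.

Lemma compactly_dominated_support n (M : R) (f : 'rV[R]_n -> R) : 0 <= M -> continuous f ->
  (forall v, ~~ box M v -> f v = 0) -> compactly_dominated f.
Proof.
move=> M0 /(continuous_bounded_box M)[K [K0 fK]] f0.
exists M, K; split=> // v; case: (boolP (box M v)) => h.
  by rewrite mulr1 fK.
by rewrite f0// normr0 mulr0.
Qed.

(** A form of the mean value theorem covering increments of either sign, suited to bounding
    difference quotients. *)
Lemma mean_value (g dg : R -> R) (r t : R) : (forall x : R, is_derive x 1 g (dg x)) ->
  exists2 c, `|c - r| <= `|t| & g (t + r) - g r = dg c * t.
Proof.
move=> dgE.
have cg a b : {within `[a, b], continuous g}.
  apply: derivable_within_continuous => x _.
  by have [] := dgE x.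
have [t0|t0|->] := ltgtP t 0; last first.
- by exists r; rewrite ?subrr ?normr0// add0r subrr mulr0.
- have rt : r <= t + r by lra.
  have [c] := MVT_segment rt (fun x _ => dgE x) (cg _ _).
  rewrite in_itv/= => /andP[h1 h2] ->; exists c; last by rewrite addrK.
  by rewrite !ger0_norm; lra.
- have rt : t + r <= r by lra.
  have [c] := MVT_segment rt (fun x _ => dgE x) (cg _ _).
  rewrite in_itv/= => /andP[h1 h2] E; exists c.
    by rewrite !ler0_norm; lra.
  by rewrite -opprB E; ring.
Qed.

End TranslationDifferentiation.

(** * Differentiation under the integral sign *)

Section DerivativeUnderIntegral.
Variable R : realType.

Lemma vtail_cons n t (v : 'rV[R]_n) : vtail (vcons t v) = v.
Proof. by apply/rowP => i; rewrite mxE vconsS. Qed.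

Lemma continuous_vtail n : continuous (@vtail R n).
Proof.
move=> w; apply: (@cvg_rV _ _ (nbhs w)) => i; rewrite mxE.
under eq_fun do rewrite mxE.
exact: coord_continuous.
Qed.

Lemma is_derive_cvg (F : R -> R) (r l : R) :
  h^-1 * (F (h + r) - F r) @[h --> 0^'] --> l -> is_derive r 1 F l.
Proof.
move=> h.
have E : (fun x : R => x^-1 *: ((F \o shift r) (x *: (1:R)) - F r)) =
    (fun x => x^-1 * (F (x + r) - F r)).
  by apply/funext => x /=; rewrite scaler1.
apply: DeriveDef; last by rewrite /derive E; exact: cvg_lim h.
by rewrite /derivable E; apply/cvg_ex; exists l.
Qed.

(** Joint continuity in (x, v) is phrased as continuity on R^(n+1), so that compactness of a box
    there bounds df uniformly for |x - r| <= 1. By the mean value theorem the same bound dominates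
    the difference quotients. *)
Lemma is_derive_rint n (f df : R -> 'rV[R]_n -> R) (M r : R) : 0 <= M ->
  (forall (x : R) v, is_derive x 1 (f ^~ v) (df x v)) ->
  continuous (fun w : 'rV[R]_n.+1 => f (w ord0 ord0) (vtail w)) ->
  continuous (fun w : 'rV[R]_n.+1 => df (w ord0 ord0) (vtail w)) ->
  (forall (x : R) v, `|x - r| <= 1 -> ~~ box M v -> f x v = 0 /\ df x v = 0) ->
  is_derive r 1 (fun x : R => rint n (f x)) (rint n (df r)).
Proof.
move=> M0 dfE cf cdf supp.
have sl (g : R -> 'rV[R]_n -> R) x :
    continuous (fun w : 'rV[R]_n.+1 => g (w ord0 ord0) (vtail w)) -> continuous (g x).
  move=> /(@continuous_slice _ _ _ x).
  by under eq_fun do rewrite vcons0 vtail_cons.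
have tf x : `|x - r| <= 1 -> tame (f x).
  move=> xr; apply: tame_continuous; first exact: sl.
  by apply: (compactly_dominated_support M0); [exact: sl|move=> v /(supp x v xr)[]].
have [K [K0 dK]] := continuous_bounded_box (Num.max M (1 + `|r|)) cdf.
have dfK x v : `|x - r| <= 1 -> `|df x v| <= K * (box M v)%:R.
  move=> xr; case: (boolP (box M v)) => bv; last first.
    by rewrite (supp _ _ xr bv).2 normr0 mulr0.
  rewrite mulr1; have := dK (vcons x v); rewrite vcons0 vtail_cons; apply.
  rewrite box_cons; apply/andP; split.
    rewrite le_max; apply/orP; right.
    by rewrite -[x](subrK r) (le_trans (ler_normD _ _))// lerD2r.
  by apply/forallP => i; rewrite le_max (forallP bv).
apply: is_derive_cvg; apply/cvgr_dnbhsP => u0 [u0_neq0 u0_cvg].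
(* [tame_cvg] asks for domination at every index and not just eventually, so the finitely many large
   increments are replaced by the harmless nonzero value 1. *)
pose u k := if `|u0 k| <= 1 then u0 k else 1.
have uE : \forall k \near \oo, u k = u0 k.
  have : \forall k \near \oo, `|u0 k| < 1.
    by have /cvgr0Pnorm_lt := u0_cvg; apply.
  by apply: filterS => k hk; rewrite /u (ltW hk).
have u_cvg : u k @[k --> \oo] --> 0.
  apply: (cvg_trans _ u0_cvg); apply: near_eq_cvg.
  by apply: filterS uE => k ->.
have u_neq0 k : u k != 0 by rewrite /u; case: ifP; rewrite ?oner_neq0.
have u1 k : `|u k| <= 1 by rewrite /u; case: ifP; rewrite ?normr1.
pose q k v := (u k)^-1 * (f (u k + r) v - f r v).
suff : rint n (q k) @[k --> \oo] --> rint n (df r).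
  apply: cvg_trans; apply: near_eq_cvg.
  apply: filterS uE => k <-.
  have t1 : tame (f (u k + r)) by apply: tf; rewrite addrK.
  have t0 : tame (f r) by apply: tf; rewrite subrr normr0.
  have [t2 E2] := tameDZ (-1) t1 t0.
  have [_ E3] := tameZ (u k)^-1 t2.
  rewrite mulN1r in E2; rewrite -E2 -E3 /q; congr rint; apply/funext => v.
  by rewrite mulN1r.
apply: (@tame_cvg _ _ M K _ _ M0 _ _ _).2.
- move=> k v; exact: (cvgM (cvg_cst _) (cvgB (sl _ _ cf v) (sl _ _ cf v))).
- move=> k v; have [c cu E] := mean_value r (u k) (fun x => dfE x v).
  rewrite /q E mulrC mulfK//; apply: dfK.
  exact: le_trans cu (u1 k).
- move=> v; have [dv dE] := dfE r v.
  have : h^-1 *: (f (h *: 1 + r) v - f r v) @[h --> 0^'] --> df r v.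
    by rewrite -dE.
  move/cvgr_dnbhsP => /(_ u (conj u_neq0 u_cvg)).
  by apply: cvg_trans; apply: near_eq_cvg; apply: nearW => k /=; rewrite scaler1.
Qed.

End DerivativeUnderIntegral.

(** * Radial means and the Laplacian *)

Section RadialFlow.
Variable R : realType.

Lemma continuous_sum (T : topologicalType) I (r : seq I) (f : I -> T -> R) :
  (forall i, continuous (f i)) -> continuous (fun x => \sum_(i <- r) f i x).
Proof.
move=> cf; elim: r => [|i r IH].
  by under eq_fun do rewrite big_nil; exact: cst_continuous.
have -> : (fun x => \sum_(j <- i :: r) f j x) = (fun x => f i x + \sum_(j <- r) f j x).
  by apply/funext => x; rewrite big_cons.
by move=> x; apply: cvgD; [exact: cf|exact: IH].
Qed.

Lemma continuous_mul_fun (T : topologicalType) (f g : T -> R) :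
  continuous f -> continuous g -> continuous (fun x => f x * g x).
Proof. by move=> cf cg x; apply: cvgM; [exact: cf|exact: cg]. Qed.

Lemma continuous_add_fun (T : topologicalType) (V : normedModType R) (f g : T -> V) :
  continuous f -> continuous g -> continuous (fun x => f x + g x).
Proof. by move=> cf cg x; apply: cvgD; [exact: cf|exact: cg]. Qed.

Lemma continuous_opp_fun (T : topologicalType) (V : normedModType R) (f : T -> V) :
  continuous f -> continuous (fun x => - f x).
Proof. by move=> cf x; apply: cvgN; exact: cf. Qed.

Lemma continuous_scale_fun (T : topologicalType) (V : normedModType R) (k : T -> R) (f : T -> V) :
  continuous k -> continuous f -> continuous (fun x => k x *: f x).
Proof. by move=> ck cf x; apply: cvgZ; [exact: ck|exact: cf]. Qed.

Lemma continuous_comp_fun (S T U : topologicalType) (f : S -> T) (g : T -> U) :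
  continuous f -> continuous g -> continuous (fun x => g (f x)).
Proof. by move=> cf cg x; apply: continuous_comp; [exact: cf|exact: cg]. Qed.

(** Radial weights are written as functions of the squared norm because, unlike [enorm], it is
    differentiable at the origin. *)
Definition sqnorm n (z : 'rV[R]_n) := \sum_(i < n) z ord0 i ^+ 2.

Lemma sqnorm_ge0 n (z : 'rV[R]_n) : 0 <= sqnorm z.
Proof. by apply: sumr_ge0 => i _; exact: sqr_ge0. Qed.

Lemma continuous_sqnorm n : continuous (@sqnorm n).
Proof.
apply: continuous_sum => i.
by apply: (@continuous_mul_fun _ (fun z : 'rV[R]_n => z ord0 i)) => z; exact: coord_continuous.
Qed.

Lemma sqnorm_evec n (z : 'rV[R]_n) (i : 'I_n) t :
  sqnorm (z + t *: evec n i) = sqnorm z + 2 * t * z ord0 i + t ^+ 2.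
Proof.
rewrite /sqnorm (bigD1 i)//= [in RHS](bigD1 i)//= !mxE !eqxx mulr1.
rewrite (eq_bigr (fun j => z ord0 j ^+ 2)); last first.
  by move=> j ji; rewrite !mxE eqxx/= (negbTE ji) mulr0 addr0.
by ring.
Qed.

(** Some coordinate exceeds B + 1 in absolute value, and (B + 1)^2 >= B. The radius B + 1 serves in
    place of the square root of B. *)
Lemma outside_box_sqnorm n B (z : 'rV[R]_n) : 0 <= B -> ~~ box (B + 1) z -> B <= sqnorm z.
Proof.
move=> B0; rewrite negb_forall => /existsP[i]; rewrite -ltNge => h.
apply: (@le_trans _ _ (z ord0 i ^+ 2)).
  by rewrite -real_normK ?num_real//; nra.
rewrite /sqnorm (bigD1 i)//= lerDl; apply: sumr_ge0 => j _; exact: sqr_ge0.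
Qed.

Lemma differential_partial n (v : 'rV[R]_n -> R) y w : differentiable v y ->
  'D_w v y = \sum_(i < n) w ord0 i * partial n i v y.
Proof.
move=> dv; rewrite deriveE// [in LHS](row_sum_delta w) linear_sum.
by apply: eq_bigr => i _; rewrite linearZ /= /partial deriveE.
Qed.

Lemma is_derive_line n (v : 'rV[R]_n -> R) (a w : 'rV[R]_n) (t : R) :
  differentiable v (a + t *: w) ->
  is_derive t 1 (fun s : R => v (a + s *: w)) (\sum_(i < n) w ord0 i * partial n i v (a + t *: w)).
Proof.
move=> dv; apply: is_derive_cvg; rewrite -differential_partial//.
have := @diff_derivable _ _ _ _ _ w dv.
rewrite /derivable => /cvg_ex[l hl].
have E : 'D_w v (a + t *: w) = l by exact: cvg_lim hl.
rewrite E; move: hl; apply: cvg_trans; apply: near_eq_cvg; apply: nearW => h /=.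
by rewrite scalerDl addrCA.
Qed.

(** The integral of h(z + t e_i) is constant in t by translation invariance, while differentiating
    it under the integral at t = 0 gives the integral of dh. *)
Lemma rint_partial_eq0 n (h dh : 'rV[R]_n -> R) (i : 'I_n) M : 0 <= M ->
  (forall z (t : R), is_derive t 1 (fun s : R => h (z + s *: evec n i)) (dh (z + t *: evec n i))) ->
  continuous h -> continuous dh ->
  (forall z, ~~ box M z -> h z = 0 /\ dh z = 0) -> rint n dh = 0.
Proof.
move=> M0 hd ch cdh supp.
have cshift : continuous (fun w : 'rV[R]_n.+1 => vtail w + w ord0 ord0 *: evec n i).
  apply: continuous_add_fun; first exact: continuous_vtail.
  by apply: continuous_scale_fun; [exact: coord_continuous|exact: cst_continuous].
(* A shift of length at most 1 moves the support by at most 1, hence the box of radius M + 1. *)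
have suppS x v : `|x - 0| <= 1 -> ~~ box (M + 1) v -> ~~ box M (v + x *: evec n i).
  rewrite subr0 => x1; apply: contraNN => /forallP bv; apply/forallP => j.
  have -> : v ord0 j = (v + x *: evec n i) ord0 j - x * (j == i)%:R.
    by rewrite !mxE eqxx/=; ring.
  apply: le_trans (ler_normB _ _) _; rewrite lerD// normrM.
  by case: (j == i); rewrite ?normr1 ?mulr1// normr0 mulr0.
have D : is_derive (0 : R) 1 (fun x : R => rint n (fun v => h (v + x *: evec n i)))
    (rint n (fun v => dh (v + 0 *: evec n i))).
  apply: (@is_derive_rint _ _ (fun x v => h (v + x *: evec n i))
    (fun x v => dh (v + x *: evec n i)) (M + 1)).
  - by rewrite addr_ge0.
  - exact: continuous_comp_fun cshift ch.
  - exact: continuous_comp_fun cshift cdh.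
  - by move=> x v x1 bv; apply: supp; exact: suppS.
have cd : compactly_dominated h.
  by apply: (compactly_dominated_support M0) => // v /supp[].
have : (fun x : R => rint n (fun v => h (v + x *: evec n i))) = cst (rint n h).
  by apply/funext => x; exact: rint_translation.
move=> E; rewrite E in D.
have := @derive_val _ _ _ _ _ _ _ D; rewrite derive_cst => /esym.
by under eq_fun do rewrite scale0r addr0.
Qed.

Definition laplacian n (u : 'rV[R]_n -> R) y := \sum_(i < n) partial n i (partial n i u) y.

Definition twice_smooth n (u : 'rV[R]_n -> R) :=
  [/\ forall y, differentiable u y,
      forall i y, differentiable (partial n i u) y &
      forall i, continuous (partial n i (partial n i u))].

(** G(y) is minus the integral of g over [y, +oo[. The bound -1 is an arbitrary point to the left of
    the values of [sqnorm]; it makes G differentiable at 0 as well and serves as base point in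
    [radial_primitive_exists]. *)
Definition radial_primitive (B : R) (g G : R -> R) :=
  [/\ 0 <= B, continuous g, forall x : R, -1 < x -> is_derive x 1 G (g x) &
      forall x, B <= x -> g x = 0 /\ G x = 0].

Lemma continuous_primitive n B g G : radial_primitive B g G ->
  continuous (fun z : 'rV[R]_n => G (sqnorm z)).
Proof.
move=> [B0 cg dG supp] z; apply: continuous_comp; first exact: continuous_sqnorm.
have h : -1 < sqnorm z by have := sqnorm_ge0 z; lra.
by apply: differentiable_continuous; apply/derivable1_diffP; case: (dG _ h).
Qed.

(** The factor z_i g(|z|^2) is the i-th partial derivative of G(|z|^2) / 2, and differentiating v(x
    + r z) in z_i brings out r. Apply [rint_partial_eq0] to the product v(x + r z) G(|z|^2) / 2. *)
Lemma radial_ibp n B g G (v : 'rV[R]_n -> R) (i : 'I_n) x r : radial_primitive B g G ->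
  (forall y, differentiable v y) -> continuous (partial n i v) ->
  rint n (fun z : 'rV[R]_n => v (x + r *: z) * (z ord0 i * g (sqnorm z))) =
  - (r * rint n (fun z : 'rV[R]_n => partial n i v (x + r *: z) * (G (sqnorm z) / 2))).
Proof.
move=> gG dv cdv; have [B0 cg dG supp] := gG.
have cG := @continuous_primitive n _ _ _ gG.
have cgs : continuous (fun z : 'rV[R]_n => g (sqnorm z)).
  exact: continuous_comp_fun (@continuous_sqnorm n) cg.
have cxr : continuous (fun z : 'rV[R]_n => x + r *: z).
  apply: continuous_add_fun; first exact: cst_continuous.
  by apply: continuous_scale_fun; [exact: cst_continuous|move=> z; exact: cvg_id].
have cv : continuous v by move=> y; exact: differentiable_continuous.
have cz : continuous (fun z : 'rV[R]_n => z ord0 i) by move=> z; exact: coord_continuous.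
have cG2 : continuous (fun z : 'rV[R]_n => G (sqnorm z) / 2).
  by apply: continuous_mul_fun => //; exact: cst_continuous.
have c1 : continuous (fun z : 'rV[R]_n => partial n i v (x + r *: z) * (G (sqnorm z) / 2)).
  by apply: continuous_mul_fun => //; exact: continuous_comp_fun cxr cdv.
have c2 : continuous (fun z : 'rV[R]_n => v (x + r *: z) * (z ord0 i * g (sqnorm z))).
  apply: continuous_mul_fun; first exact: continuous_comp_fun cxr cv.
  exact: continuous_mul_fun.
have B1 : 0 <= B + 1 by lra.
have out z : ~~ box (B + 1) z -> g (sqnorm z) = 0 /\ G (sqnorm z) = 0.
  by move=> /(outside_box_sqnorm B0)/supp.
have t1 : tame (fun z : 'rV[R]_n => partial n i v (x + r *: z) * (G (sqnorm z) / 2)).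
  apply: tame_continuous => //; apply: (compactly_dominated_support B1) => // z /out[_ ->].
  by rewrite mul0r mulr0.
have t2 : tame (fun z : 'rV[R]_n => v (x + r *: z) * (z ord0 i * g (sqnorm z))).
  apply: tame_continuous => //; apply: (compactly_dominated_support B1) => // z /out[-> _].
  by rewrite !mulr0.
have [_] := tameDZ r t2 t1.
suff -> : rint n (fun z : 'rV[R]_n => v (x + r *: z) * (z ord0 i * g (sqnorm z)) +
    r * (partial n i v (x + r *: z) * (G (sqnorm z) / 2))) = 0.
  by move/esym/eqP; rewrite addr_eq0 => /eqP.
apply: (@rint_partial_eq0 _ (fun z : 'rV[R]_n => v (x + r *: z) * (G (sqnorm z) / 2)) _ i _ B1).
- move=> z t.
  have D1 : is_derive t 1 (fun s : R => v (x + r *: (z + s *: evec n i)))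
      (r * partial n i v (x + r *: (z + t *: evec n i))).
    have E s : x + r *: (z + s *: evec n i) = (x + r *: z) + s *: (r *: evec n i).
      by rewrite scalerDr addrA scalerA [r * s]mulrC -scalerA.
    rewrite (_ : (fun s : R => v (x + r *: (z + s *: evec n i))) =
      (fun s : R => v ((x + r *: z) + s *: (r *: evec n i)))); last first.
      by apply/funext => s; rewrite E.
    rewrite E; apply: is_derive_eq; first exact: is_derive_line.
    rewrite (bigD1 i)//= !mxE !eqxx mulr1 big1 ?addr0// => j ji.
    by rewrite !mxE eqxx/= (negbTE ji) mulr0 mul0r.
  have D2 : is_derive t 1 (fun s : R => G (sqnorm (z + s *: evec n i)))
      (2 * ((z + t *: evec n i) ord0 i) * g (sqnorm (z + t *: evec n i))).
    have dq : is_derive t 1 (fun s : R => sqnorm (z + s *: evec n i))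
        (2 * (z + t *: evec n i) ord0 i).
      rewrite (_ : (fun s : R => _) =
        (fun s : R => sqnorm z + (2 * z ord0 i) * s + s ^+ 2)); last first.
        by apply/funext => s; rewrite sqnorm_evec; ring.
      apply: is_derive_eq; rewrite !mxE !eqxx/=.
      by rewrite /GRing.scale/=; ring.
    have h : -1 < sqnorm (z + t *: evec n i).
      by have := sqnorm_ge0 (z + t *: evec n i); lra.
    have := @is_derive1_comp _ G (fun s : R => sqnorm (z + s *: evec n i)) t _ _ (dG _ h) dq.
    by rewrite /comp mulrC.
  apply: is_derive_eq.
  by rewrite /GRing.scale/=; field.
- apply: continuous_mul_fun => //; exact: continuous_comp_fun cxr cv.
- apply: continuous_add_fun => //; apply: continuous_mul_fun => //; exact: cst_continuous.
- by move=> z /out[-> ->]; rewrite mul0r !mulr0 addr0.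
Qed.

End RadialFlow.

(** * Radial means, the mean value property and comparison of primitives *)

Section MeanValue.
Variable R : realType.
Local Notation mu := (@lebesgue_measure R).

Lemma tame_radial_weight n B (g : R -> R) (f : 'rV[R]_n -> R) : 0 <= B -> continuous g ->
  (forall y, B <= y -> g y = 0) -> continuous f -> tame (fun z => f z * g (sqnorm z)).
Proof.
move=> B0 cg g0 cf.
have B1 : 0 <= B + 1 by lra.
have c : continuous (fun z => f z * g (sqnorm z)).
  by apply: continuous_mul_fun => //; exact: continuous_comp_fun (@continuous_sqnorm _ n) cg.
apply: tame_continuous => //; apply: (compactly_dominated_support B1) => // z.
by move=> /(outside_box_sqnorm B0)/g0 ->; rewrite mulr0.
Qed.

(** Differentiation under the integral leaves the sum of z_i (d_i u)(x + r z) g(|z|^2); [radial_ibp]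
    with v = d_i u turns each term into a pure second derivative. *)
Lemma is_derive_radial_mean n B (g G : R -> R) (u : 'rV[R]_n -> R) x (r : R) :
  radial_primitive B g G -> twice_smooth u ->
  is_derive r 1 (fun s : R => rint n (fun z => u (x + s *: z) * g (sqnorm z)))
    (r * rint n (fun z => laplacian u (x + r *: z) * (- (G (sqnorm z) / 2)))).
Proof.
move=> gG [du ddu cddu]; have [B0 cg dG supp] := gG.
have B1 : 0 <= B + 1 by lra.
have out (z : 'rV[R]_n) : ~~ box (B + 1) z -> g (sqnorm z) = 0 /\ G (sqnorm z) = 0.
  by move=> /(outside_box_sqnorm B0)/supp.
have cu : continuous u by move=> y; exact: differentiable_continuous.
have cdu i : continuous (partial n i u) by move=> y; exact: differentiable_continuous.
have cgs : continuous (fun z : 'rV[R]_n => g (sqnorm z)).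
  exact: continuous_comp_fun (@continuous_sqnorm _ n) cg.
have cG2 : continuous (fun z : 'rV[R]_n => G (sqnorm z) / 2).
  by apply: continuous_mul_fun; [exact: continuous_primitive gG|exact: cst_continuous].
have cxr s : continuous (fun z : 'rV[R]_n => x + s *: z).
  apply: continuous_add_fun; first exact: cst_continuous.
  by apply: continuous_scale_fun; [exact: cst_continuous|move=> z; exact: cvg_id].
have cline : continuous (fun w : 'rV[R]_n.+1 => x + w ord0 ord0 *: vtail w).
  apply: continuous_add_fun; first exact: cst_continuous.
  by apply: continuous_scale_fun; [exact: coord_continuous|exact: continuous_vtail].
pose df (s : R) (z : 'rV[R]_n) :=
  (\sum_(i < n) z ord0 i * partial n i u (x + s *: z)) * g (sqnorm z).
have cz i : continuous (fun z : 'rV[R]_n => z ord0 i) by move=> z; exact: coord_continuous.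
have D : is_derive r 1 (fun s : R => rint n (fun z => u (x + s *: z) * g (sqnorm z)))
    (rint n (df r)).
  apply: (@is_derive_rint _ _ (fun (s : R) (z : 'rV[R]_n) => u (x + s *: z) * g (sqnorm z))
    df _ _ B1).
  - move=> s z; have := is_derive_line (a := x) (w := z) (t := s) (du _) => D.
    apply: is_derive_eq.
    by rewrite /GRing.scale/= mulr0 add0r mulrC.
  - apply: (@continuous_mul_fun _ _ (fun w : 'rV[R]_n.+1 => u (x + w ord0 ord0 *: vtail w))).
      exact: continuous_comp_fun cline cu.
    exact: continuous_comp_fun (@continuous_vtail R n) cgs.
  - apply: (@continuous_mul_fun _ _ (fun w : 'rV[R]_n.+1 =>
        \sum_(i < n) vtail w ord0 i * partial n i u (x + w ord0 ord0 *: vtail w))).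
      apply: continuous_sum => i; apply: continuous_mul_fun.
        exact: continuous_comp_fun (@continuous_vtail R n) (cz i).
      exact: continuous_comp_fun cline (cdu i).
    exact: continuous_comp_fun (@continuous_vtail R n) cgs.
  - by move=> s z _ /out[gz _]; rewrite /df gz !mulr0.
apply: is_derive_eq; rewrite /df.
have tm i : tame (fun z : 'rV[R]_n => partial n i u (x + r *: z) * (z ord0 i * g (sqnorm z))).
  apply: tame_continuous.
    apply: continuous_mul_fun; first exact: continuous_comp_fun (cxr r) (cdu i).
    exact: continuous_mul_fun.
  apply: (compactly_dominated_support B1) => [|z /out[-> _]]; last by rewrite !mulr0.
  apply: continuous_mul_fun; first exact: continuous_comp_fun (cxr r) (cdu i).
  exact: continuous_mul_fun.
have tl i : tame (fun z : 'rV[R]_n =>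
    partial n i (partial n i u) (x + r *: z) * (G (sqnorm z) / 2)).
  apply: tame_continuous.
    by apply: continuous_mul_fun => //; exact: continuous_comp_fun (cxr r) (cddu i).
  apply: (compactly_dominated_support B1) => [|z /out[_ ->]]; last by rewrite mul0r mulr0.
  by apply: continuous_mul_fun => //; exact: continuous_comp_fun (cxr r) (cddu i).
transitivity (\sum_(i < n) rint n (fun z : 'rV[R]_n =>
    partial n i u (x + r *: z) * (z ord0 i * g (sqnorm z)))).
  rewrite -(tame_sum (index_enum 'I_n) tm).2; congr rint; apply/funext => z.
  by rewrite mulr_suml; apply: eq_bigr => i _; ring.
under eq_bigr => i _ do rewrite (@radial_ibp _ _ _ _ _ _ _ _ _ gG (ddu i) (cddu i)).
rewrite sumrN -mulr_sumr -mulrN -mulN1r; congr (_ * _).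
rewrite -(tame_sum (index_enum 'I_n) tl).2 -(tameZ (-1) (tame_sum (index_enum 'I_n) tl).1).2.
congr rint; apply/funext => z; rewrite /laplacian !mulr_suml mulr_sumr.
by apply: eq_bigr => i _; ring.
Qed.

Lemma harmonic_radial_mean n B (g G : R -> R) (u : 'rV[R]_n -> R) x :
  radial_primitive B g G -> twice_smooth u -> (forall y, laplacian u y = 0) ->
  rint n (fun z => (u x - u (x + z)) * g (sqnorm z)) = 0.
Proof.
move=> gG su u0.
pose F (s : R) := rint n (fun z => u (x + s *: z) * g (sqnorm z)).
have dF (s : R) : is_derive s 1 F 0.
  apply: is_derive_eq; first exact: (is_derive_radial_mean x s gG su).
  under eq_fun do rewrite u0 mul0r.
  by rewrite (tame0 R n).2 mulr0.
(* Radius 0 gives the integral of u(x) g, radius 1 that of u(x + z) g. *)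
have := @is_derive_0_is_cst _ F 0 1 dF; rewrite /F.
under eq_fun do rewrite scale0r addr0.
under [in RHS]eq_fun do rewrite scale1r.
have [B0 cg dG supp] := gG; have [du _ _] := su.
have cu : continuous u by move=> y; exact: differentiable_continuous.
have g0 y : B <= y -> g y = 0 by move=> /supp[].
have tm (f : 'rV[R]_n -> R) : continuous f -> tame (fun z => f z * g (sqnorm z)).
  exact: (tame_radial_weight B0 cg g0).
have t1 : tame (fun z : 'rV[R]_n => u x * g (sqnorm z)).
  by apply: tm; exact: cst_continuous.
have t2 : tame (fun z : 'rV[R]_n => u (x + z) * g (sqnorm z)).
  apply: tm; apply: (@continuous_comp_fun _ _ _ (fun z => x + z)) => //.
  by apply: continuous_add_fun; [exact: cst_continuous|move=> z; exact: cvg_id].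
move=> E; have [_] := tameDZ (-1) t1 t2.
rewrite E mulN1r subrr => <-; congr rint; apply/funext => z; ring.
Qed.

Lemma radial_primitive_exists B (g : R -> R) : 0 <= B -> continuous g ->
  (forall x, B <= x -> g x = 0) -> exists G, radial_primitive B g G.
Proof.
move=> B0 cg g0.
pose F x := Rintegral mu `[-1, x] g.
have ig a b : mu.-integrable `[a, b] (EFin \o g).
  apply: continuous_compact_integrable; first exact: segment_compact.
  exact: continuous_subspaceT.
have dF (x : R) : -1 < x -> is_derive x 1 F (g x).
  move=> x1; have xx : x < x + 1 by lra.
  have [d1 d2] := continuous_FTC1_closed xx (ig _ _) x1 (cg x).
  by apply: DeriveDef => //; rewrite -d2 derive1E.
exists (fun x => F x - F B); split=> //.
  move=> x x1; have := dF x x1 => D.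
  by rewrite -[X in is_derive _ _ _ X]subr0; exact: is_deriveB.
move=> x Bx; split; first exact: g0.
have -> : F x - F B = Rintegral mu `]B, x] g.
  by apply: Rintegral_itvB; [exact: ig|rewrite bnd_simp; lra|rewrite bnd_simp].
rewrite (_ : Rintegral _ _ _ = Rintegral mu `]B, x] (cst 0)).
  by rewrite Rintegral_cst// mul0r.
apply: eq_Rintegral => y; rewrite inE/= in_itv/= => /andP[/ltW /g0 ->] //.
Qed.

(** The order is reversed because the primitives are normalised to vanish far out: G' - G is
    nondecreasing on [0, +oo[ and ends at 0. *)
Lemma radial_primitive_le B B' (g G g' G' : R -> R) :
  radial_primitive B g G -> radial_primitive B' g' G' ->
  (forall y, 0 <= y -> g y <= g' y) -> forall y, 0 <= y -> G' y <= G y.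
Proof.
move=> [B0 cg dG s] [B0' cg' dG' s'] gg' y y0.
(* A point beyond both supports, where both primitives vanish. *)
pose C := Num.max y (Num.max B B').
have [_ GC] : g C = 0 /\ G C = 0 by apply: s; rewrite !le_max lexx orbT.
have [_ GC'] : g' C = 0 /\ G' C = 0 by apply: s'; rewrite !le_max lexx !orbT.
have yC : y <= C by rewrite le_max lexx.
have D (z : R) : z \in `]y, C[ -> is_derive z 1 (fun t => G' t - G t) (g' z - g z).
  rewrite in_itv/= => /andP[yz _]; have z1 : -1 < z by lra.
  have := dG' z z1; have := dG z z1 => D1 D2; exact: is_deriveB.
have c : {within `[y, C], continuous (fun t => G' t - G t)}.
  apply: derivable_within_continuous => z; rewrite in_itv/= => /andP[yz _].
  have z1 : -1 < z by lra.
  have [d1 _] := dG' z z1; have [d2 _] := dG z z1; exact: derivableB.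
have [e] := MVT_segment yC D c.
rewrite in_itv/= GC GC' subrr sub0r => /andP[ye _] E.
have : 0 <= (g' e - g e) * (C - y).
  by rewrite mulr_ge0// subr_ge0//; apply: gg'; lra.
by rewrite -E; lra.
Qed.

(** G is nondecreasing, increases strictly from a to b, and is at most 0 at b by comparison with the
    zero weight. *)
Lemma radial_primitive_lt0 B (g G : R -> R) a b : radial_primitive B g G ->
  (forall y, 0 <= g y) -> 0 <= a < b -> (forall y, a < y < b -> 0 < g y) -> G 0 < 0.
Proof.
move=> gG g0 /andP[a0 ab] gab; have [B0 cg dG s] := gG.
have le0 y : 0 <= y -> G y <= 0.
  have Z0 : radial_primitive 0 (fun=> 0 : R) (fun=> 0 : R).
    split=> //; first exact: cst_continuous.
    by move=> x _; exact: is_derive_cst.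
  exact: (radial_primitive_le Z0 gG).
have D (z : R) : -1 < z -> derivable G z 1 by move=> /dG[].
have mono (c d : R) : 0 <= c -> c < d ->
    exists2 e, e \in `]c, d[ & G d - G c = g e * (d - c).
  move=> c0 cd; apply: (MVT cd).
    by move=> z; rewrite in_itv/= => /andP[cz _]; apply: dG; lra.
  apply: derivable_within_continuous => z; rewrite in_itv/= => /andP[cz _].
  by apply: D; lra.
have [e] := mono a b a0 ab; rewrite in_itv/= => eab E.
have h1 : 0 < g e * (b - a) by rewrite mulr_gt0 ?gab//; lra.
have h2 : G b <= 0 by apply: le0; lra.
move: a0; rewrite le_eqVlt => /orP[/eqP a0|a0]; first by rewrite a0; lra.
have [e' _ E'] := mono 0 a (lexx _) a0.
have h3 : 0 <= g e' * (a - 0) by rewrite mulr_ge0//; lra.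
lra.
Qed.

End MeanValue.

(** * Polynomial functions *)

Section PolynomialFunctions.
Variable R : realType.

(** An inductive closure instead of sums of monomials: smoothness, stability under partial
    derivatives and expansion along lines all become structural inductions. *)
Inductive polyfun n : ('rV[R]_n -> R) -> Prop :=
| polyfun_cst c : polyfun (fun=> c)
| polyfun_coord i : polyfun (fun x => x ord0 i)
| polyfunD f g : polyfun f -> polyfun g -> polyfun (fun x => f x + g x)
| polyfunM f g : polyfun f -> polyfun g -> polyfun (fun x => f x * g x).

Lemma derive_coord n (y v : 'rV[R]_n) j : 'D_v (fun x : 'rV[R]_n => x ord0 j) y = v ord0 j.
Proof.
have := @derive_mx R 'rV[R]_n 1 n id y v (@derivable_id _ _ _ _).
by rewrite derive_id => /matrixP/(_ ord0 j); rewrite mxE.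
Qed.

Lemma polyfun_smooth n (f : 'rV[R]_n -> R) : polyfun f ->
  (forall y, differentiable f y) /\ forall i, polyfun (partial n i f).
Proof.
elim=> [c|j|f1 f2 _ [d1 p1] _ [d2 p2]|f1 f2 P1 [d1 p1] P2 [d2 p2]].
- split=> [y|i]; first exact: differentiable_cst.
  rewrite (_ : partial n i _ = fun=> 0); first exact: polyfun_cst.
  by apply/funext => y; exact: derive_cst.
- split=> [y|i]; first exact: differentiable_coord.
  rewrite (_ : partial n i _ = fun=> evec n i ord0 j); first exact: polyfun_cst.
  by apply/funext => y; exact: derive_coord.
- split=> [y|i]; first exact: differentiableD.
  rewrite (_ : partial n i _ = (fun y => partial n i f1 y + partial n i f2 y)).
    exact: polyfunD.
  by apply/funext => y; apply: deriveD; exact: diff_derivable.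
- split=> [y|i]; first exact: differentiableM.
  rewrite (_ : partial n i _ = (fun y => f1 y * partial n i f2 y + f2 y * partial n i f1 y)).
    by apply: polyfunD; exact: polyfunM.
  by apply/funext => y; apply: deriveM; exact: diff_derivable.
Qed.

Lemma polyfun_twice_smooth n (f : 'rV[R]_n -> R) : polyfun f ->
  twice_smooth f /\
  forall i j, continuous (partial n j (partial n i f)).
Proof.
move=> pf; have [d1 p1] := polyfun_smooth pf.
have H i j : continuous (partial n j (partial n i f)).
  have [_ /(_ j)/polyfun_smooth[d _]] := polyfun_smooth (p1 i).
  by move=> y; exact: differentiable_continuous.
by split=> //; split=> // i; have [] := polyfun_smooth (p1 i).
Qed.

Lemma polyfun_sum n I (r : seq I) P (F : I -> 'rV[R]_n -> R) : (forall i, polyfun (F i)) ->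
  polyfun (fun y => \sum_(i <- r | P i) F i y).
Proof.
move=> pF; elim: r => [|i r IH].
  by under eq_fun do rewrite big_nil; exact: polyfun_cst.
under eq_fun do rewrite big_cons.
by case: (P i) => //; exact: polyfunD.
Qed.

Lemma polyfun_prod n I (r : seq I) (F : I -> 'rV[R]_n -> R) : (forall i, polyfun (F i)) ->
  polyfun (fun y => \prod_(i <- r) F i y).
Proof.
move=> pF; elim: r => [|i r IH].
  by under eq_fun do rewrite big_nil; exact: polyfun_cst.
under eq_fun do rewrite big_cons.
exact: polyfunM.
Qed.

Lemma polyfun_exp n k (f : 'rV[R]_n -> R) : polyfun f -> polyfun (fun y => f y ^+ k).
Proof.
move=> pf; elim: k => [|k IH].
  by under eq_fun do rewrite expr0; exact: polyfun_cst.
by under eq_fun do rewrite exprS; exact: polyfunM.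
Qed.

Lemma polyfun_laplacian n (f : 'rV[R]_n -> R) : polyfun f -> polyfun (laplacian f).
Proof.
move=> pf; apply: polyfun_sum => i.
have [_ /(_ i)/polyfun_smooth[_ p]] := polyfun_smooth pf; exact: p.
Qed.

Lemma hom_poly_polyfun n m (p : 'rV[R]_n -> R) : hom_poly n m p ->
  polyfun p /\ forall (c : R) x, p (c *: x) = c ^+ m * p x.
Proof.
move=> [b ->]; split.
  apply: polyfun_sum => a; apply: polyfunM; first exact: polyfun_cst.
  by apply: polyfun_prod => i; apply: polyfun_exp; exact: polyfun_coord.
move=> c x; rewrite mulr_sumr; apply: eq_bigr => a /eqP aE.
rewrite mulrCA; congr (_ * _).
rewrite -[in c ^+ _]aE -prodrXr -big_split/=.
by apply: eq_bigr => i _; rewrite mxE exprMn.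
Qed.

(** The size bound is uniform in z, so that integrals over z can be taken coefficient by coefficient
    in a fixed finite sum; continuity of the coefficients makes each weighted integrand tame. *)
Lemma polyfun_line n (p : 'rV[R]_n -> R) x : polyfun p ->
  exists (P : 'rV[R]_n -> {poly R}) (d : nat),
    [/\ forall z t, (P z).[t] = p (x + t *: z),
        forall k, continuous (fun z => (P z)`_k) &
        forall z, (size (P z) <= d)%N].
Proof.
elim=> [c|i|f g _ [P [d [P1 P2 P3]]] _ [Q [e [Q1 Q2 Q3]]]
       |f g _ [P [d [P1 P2 P3]]] _ [Q [e [Q1 Q2 Q3]]]].
- exists (fun=> c%:P), 1; split=> [z t|k|z].
  + by rewrite hornerC.
  + exact: cst_continuous.
  + exact: size_polyC_leq1.
- exists (fun z => (x ord0 i)%:P + z ord0 i *: 'X), 2; split=> [z t|k|z].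
  + by rewrite !hornerE !mxE mulrC.
  + under eq_fun do rewrite coefD coefC coefZ coefX.
    apply: continuous_add_fun; first exact: cst_continuous.
    apply: continuous_mul_fun; last exact: cst_continuous.
    by move=> z; exact: coord_continuous.
  + rewrite (leq_trans (size_polyD _ _))// geq_max.
    by rewrite (leq_trans (size_polyC_leq1 _))//= (leq_trans (size_scale_leq _ _))// size_polyX.
- exists (fun z => P z + Q z), (maxn d e); split=> [z t|k|z].
  + by rewrite hornerD P1 Q1.
  + under eq_fun do rewrite coefD.
    exact: continuous_add_fun.
  + by rewrite (leq_trans (size_polyD _ _))// geq_max !leq_max P3 Q3 orbT.
- exists (fun z => P z * Q z), (d + e)%N; split=> [z t|k|z].
  + by rewrite hornerM P1 Q1.
  + under eq_fun do rewrite coefM.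
    apply: continuous_sum => j.
    exact: continuous_mul_fun.
  + by rewrite (leq_trans (size_polyMleq _ _))// (leq_trans (leq_pred _))// leq_add.
Qed.

(** The natural numbers below [size p] would be too many distinct roots for a nonzero p. *)
Lemma poly_eq0_horner (p : {poly R}) : (forall t, p.[t] = 0) -> p = 0.
Proof.
move=> p0; apply/eqP; apply: contraT => pn0.
have := @max_poly_roots _ p [seq i%:R | i <- iota 0 (size p)] pn0 _ _.
rewrite size_map size_iota ltnn; apply.
  by apply/allP => y _; rewrite /root p0.
by rewrite map_inj_uniq ?iota_uniq//; exact: mulrIn (oner_neq0 _).
Qed.

Lemma radial_mean_poly n B (g : R -> R) (p : 'rV[R]_n -> R) x (P : 'rV[R]_n -> {poly R}) d r :
  0 <= B -> continuous g -> (forall y, B <= y -> g y = 0) ->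
  (forall z t, (P z).[t] = p (x + t *: z)) -> (forall k, continuous (fun z => (P z)`_k)) ->
  (forall z, (size (P z) <= d)%N) ->
  rint n (fun z => p (x + r *: z) * g (sqnorm z)) =
  (\poly_(k < d) rint n (fun z => (P z)`_k * g (sqnorm z))).[r].
Proof.
move=> B0 cg g0 P1 P2 P3.
have tm k : tame (fun z => (P z)`_k * g (sqnorm z)) by exact: (tame_radial_weight B0 cg g0 (P2 k)).
rewrite horner_poly.
have tmr (k : 'I_d) := tameZ (r ^+ k) (tm k).
under eq_bigr do rewrite mulrC -(tmr _).2.
rewrite -(tame_sum (index_enum 'I_d) (fun k => (tmr k).1)).2.
congr rint; apply/funext => z; rewrite -P1 (horner_coef_wide _ (P3 z)) mulr_suml.
by apply: eq_bigr => k _; ring.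
Qed.

(* Comparing coefficients in [F' r = r H r] gives [2 F_2 = H 0]. *)
Lemma second_coef_radial_mean n B (g G : R -> R) (p : 'rV[R]_n -> R) x
    (P : 'rV[R]_n -> {poly R}) d :
  radial_primitive B g G -> polyfun p ->
  (forall z t, (P z).[t] = p (x + t *: z)) -> (forall k, continuous (fun z => (P z)`_k)) ->
  (forall z, (size (P z) <= d)%N) ->
  rint n (fun z => (P z)`_2 * g (sqnorm z)) =
  laplacian p x * (rint n (fun z : 'rV[R]_n => - (G (sqnorm z))) / 4).
Proof.
move=> gG pp P1 P2 P3; have [B0 cg dG supp] := gG.
have g0 y : B <= y -> g y = 0 by move=> /supp[].
have [sp _] := polyfun_twice_smooth pp.
have lp := polyfun_laplacian pp.
have [Q [e [Q1 Q2 Q3]]] := polyfun_line x lp.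
have B1 : 0 <= B + 1 by lra.
have cG : continuous (fun z : 'rV[R]_n => - G (sqnorm z)).
  by apply: continuous_opp_fun; exact: continuous_primitive gG.
have tG (f : 'rV[R]_n -> R) : continuous f -> tame (fun z => f z * - G (sqnorm z)).
  move=> cf.
  have c : continuous (fun z => f z * - G (sqnorm z)) by exact: continuous_mul_fun.
  apply: tame_continuous => //; apply: (compactly_dominated_support B1) => // z.
  by move=> /(outside_box_sqnorm B0)/supp[_ ->]; rewrite oppr0 mulr0.
have tg k : tame (fun z => (P z)`_k * g (sqnorm z)) by exact: (tame_radial_weight B0 cg g0 (P2 k)).
pose F := \poly_(k < d) rint n (fun z => (P z)`_k * g (sqnorm z)).
pose H := \poly_(k < e) (rint n (fun z => (Q z)`_k * - G (sqnorm z)) / 2).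
have FE r : rint n (fun z => p (x + r *: z) * g (sqnorm z)) = F.[r].
  exact: (@radial_mean_poly _ B _ _ _ _ d).
have HE r : rint n (fun z => laplacian p (x + r *: z) * - (G (sqnorm z) / 2)) = H.[r].
  rewrite /H horner_poly.
  have tmr (k : 'I_e) := tameZ (r ^+ k / 2) (tG _ (Q2 k)).
  transitivity (\sum_(k < e) rint n (fun z => r ^+ k / 2 * ((Q z)`_k * - G (sqnorm z)))).
    rewrite -(tame_sum (index_enum 'I_e) (fun k => (tmr k).1)).2.
    congr rint; apply/funext => z; rewrite -Q1 (horner_coef_wide _ (Q3 z)) mulr_suml.
    by apply: eq_bigr => k _; field.
  by apply: eq_bigr => k _; rewrite (tmr k).2; field.
have E : F^`() = 'X * H.
  apply/eqP; rewrite -subr_eq0; apply/eqP/poly_eq0_horner => r.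
  have D := is_derive_radial_mean x r gG sp.
  have E1 : (fun s : R => rint n (fun z : 'rV[R]_n => p (x + s *: z) * g (sqnorm z))) = horner F.
    by apply/funext => s; exact: FE.
  rewrite E1 HE in D.
  rewrite hornerD hornerN hornerM hornerX.
  have := @derive_val _ _ _ _ _ _ _ D.
  by rewrite -derive1E -derivE => ->; rewrite subrr.
(* The coefficient of F' is twice F_2; with the factor 1/2 in H this accounts for the 4 in the
   statement. *)
have := congr1 (fun q : {poly R} => q`_1) E; rewrite coef_deriv coefXM/= => E2.
have F2 : F`_2 = rint n (fun z => (P z)`_2 * g (sqnorm z)).
  rewrite coef_poly; case: ltnP => // d2.
  rewrite -[LHS](tame0 R n).2; congr rint; apply/funext => z.
  by rewrite nth_default ?mul0r// (leq_trans (P3 z)).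
have H0 : H`_0 = laplacian p x * (rint n (fun z : 'rV[R]_n => - (G (sqnorm z))) / 2).
  rewrite -horner_coef0 -HE.
  under eq_fun do rewrite scale0r addr0.
  have t1 : tame (fun z : 'rV[R]_n => 1 * - G (sqnorm z)) by apply: tG; exact: cst_continuous.
  have [_] := tameZ (laplacian p x / 2) t1.
  under [in X in _ = X -> _]eq_fun do rewrite mul1r.
  move=> h; transitivity (laplacian p x / 2 * rint n (fun z : 'rV[R]_n => - G (sqnorm z))).
    by rewrite -h; congr rint; apply/funext => z; field.
  by field.
rewrite -F2; move: E2; rewrite H0 => E2.
by apply: (@mulIf _ 2); rewrite ?pnatr_eq0// mulr_natr E2; field.
Qed.

End PolynomialFunctions.

(** * Positivity of the Gamma function *)

Section GammaPositive.
Variable R : realType.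
Local Notation mu := (@lebesgue_measure R).

(** With an integer n >= z, both 1 and t^z are at most (1 + t)^n, so the square is at most 4 (1 +
    t)^(2n); and 1 + t <= 2n exp(t / 2n). *)
Lemma sqr_1DpowR_le_expR (z : R) : 0 < z ->
  exists C : R, 0 < C /\ forall t, 0 < t -> (1 + t `^ z) ^+ 2 <= C * expR t.
Proof.
move=> z0; pose n := (Num.truncn z).+1.
have zn : z <= n%:R by exact/ltW/truncnS_gt.
have n0 : 0 < (2 * n)%:R :> R by rewrite ltr0n.
exists (4 * (2 * n)%:R ^+ (2 * n)); split=> [|t t0]; first by rewrite mulr_gt0 ?exprn_gt0.
have t1 : 1 <= 1 + t by lra.
have h1 : t `^ z <= (1 + t) ^+ n.
  apply: (@le_trans _ _ ((1 + t) `^ z)).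
    by apply: ge0_ler_powR; rewrite ?nnegrE; lra.
  by rewrite -powR_mulrn; [exact: ler_powR|lra].
have h2 : 1 <= (1 + t) ^+ n by exact: exprn_ege1.
have h3 : 1 + t <= (2 * n)%:R * expR (t / (2 * n)%:R).
  apply: (@le_trans _ _ ((2 * n)%:R * (1 + t / (2 * n)%:R))); last first.
    by rewrite ler_pM2l// expR_ge1Dx.
  rewrite mulrDr mulr1 mulrCA divff ?gt_eqF// mulr1 lerD2r.
  by rewrite ler1n.
have h4 : (1 + t) ^+ (2 * n) <= (2 * n)%:R ^+ (2 * n) * expR t.
  rewrite -[t in expR t](@divfK _ (2 * n)%:R) ?gt_eqF// [_ / _ * _]mulrC expRM_natl -exprMn.
  apply: lerXn2r => //; rewrite nnegrE; first lra.
  by rewrite mulr_ge0 ?expR_ge0// ltW.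
apply: (@le_trans _ _ (4 * (1 + t) ^+ (2 * n))); last by rewrite -mulrA ler_pM2l.
have h5 : 0 <= t `^ z := powR_ge0 _ _.
rewrite mulnC exprM; set y := (1 + t) ^+ n in h1 h2 *; nra.
Qed.

(** The integrand is compared with h(t) = C t^(z-1) / (1 + t^z)^2, whose primitive H = -(C/z) / (1 +
    t^z) stays between -C/z and 0. This controls the singularity at 0 and the tail at once, so the
    half-line need not be split. *)
Lemma gamma_integral_fin (z : R) : 0 < z ->
  (\int[mu]_(t in `]0%R, +oo[) (t `^ (z - 1) * expR (- t))%:E < +oo)%E.
Proof.
move=> z0; have [C [C0 hC]] := sqr_1DpowR_le_expR z0.
pose f t : R := t `^ (z - 1) * expR (- t).
pose H t : R := - (C / z) * (1 + t `^ z)^-1.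
pose h t : R := C * t `^ (z - 1) / (1 + t `^ z) ^+ 2.
have p1 t : 0 < 1 + t `^ z by have := powR_ge0 t z; lra.
have f0 t : 0 <= f t by rewrite mulr_ge0 ?powR_ge0 ?expR_ge0.
have mf : measurable_fun setT f.
  apply: measurable_funM; first exact: measurable_powR.
  by apply: measurableT_comp => //; exact: measurable_expR.
have fh t : 0 < t -> f t <= h t.
  move=> t0; rewrite /f /h -mulrA mulrCA ler_wpM2l ?powR_ge0//.
  rewrite expRN ler_pdivlMr ?exprn_gt0// mulrC ler_pdivrMr ?expR_gt0//.
  exact: hC.
have dp (t : R) : 0 < t -> is_derive t 1 (fun x : R => 1 + x `^ z) (z * t `^ (z - 1)).
  move=> t0; have := is_derive1_powR z t0 => D; apply: is_derive_eq.
  by rewrite add0r mul1r.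
have dH (t : R) : 0 < t -> is_derive t 1 H (h t).
  move=> t0.
  have dV : is_derive t 1 (fun x : R => (1 + x `^ z)^-1) (- (1 + t `^ z) ^- 2 *: (z * t `^ (z - 1))).
    by apply: is_deriveV; [rewrite gt_eqF|exact: dp].
  apply: is_derive_eq; rewrite /h /GRing.scale/=.
  field; rewrite ?gt_eqF//.
have ch (t : R) : 0 < t -> {for t, continuous h}.
  move=> t0.
  have cp a : {for t, continuous (fun x : R => x `^ a)}.
    apply: differentiable_continuous; apply/derivable1_diffP.
    by apply: derivable_powR; rewrite in_itv/= t0.
  apply: cvgM; first by apply: cvgM; [exact: cvg_cst|exact: cp].
  apply: cvgV; first by rewrite gt_eqF ?exprn_gt0.
  by apply: cvgM; apply: cvgD; [exact: cvg_cst|exact: cp|exact: cvg_cst|exact: cp].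
have bound a b : 0 < a -> a < b -> (\int[mu]_(t in `[a, b]) (f t)%:E <= (C / z)%:E)%E.
  move=> a0 ab.
  have ab0 t : `[a, b]%classic t -> 0 < t by rewrite /= in_itv/= => /andP[at_ _]; lra.
  have cab : {within `[a, b], continuous h}.
    by apply: continuous_in_subspaceT => t /set_mem/ab0; exact: ch.
  apply: (@le_trans _ _ (\int[mu]_(t in `[a, b]) (h t)%:E)%E).
    apply: ge0_le_integral => //.
    - by move=> t _; rewrite lee_fin.
    - by apply: (measurable_EFinP _ f).2; exact: measurable_funTS.
    - by apply: (measurable_EFinP _ h).2; exact: subspace_continuous_measurable_fun.
    - by move=> t /ab0/fh; rewrite lee_fin.
  rewrite (continuous_FTC2 ab cab (F := H)).
  - rewrite -EFinB lee_fin /H.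
    have hb : 0 <= C / z * (1 + b `^ z)^-1 by rewrite !mulr_ge0 ?invr_ge0// ltW.
    have ha : C / z * (1 + a `^ z)^-1 <= C / z.
      rewrite ler_piMr ?divr_ge0 ?ltW// invf_lt1// ltrDl; exact: powR_gt0.
    lra.
  - have cH (t : R) : 0 < t -> {for t, continuous H}.
      move=> t0; apply: differentiable_continuous; apply/derivable1_diffP.
      by case: (dH t t0).
    split=> [t||].
    + by rewrite in_itv/= => /andP[at_ _]; case: (dH t (lt_trans a0 at_)).
    + by apply: cvg_at_right_filter; exact: cH.
    + by apply: cvg_at_left_filter; apply: cH; exact: lt_trans ab.
  - move=> t; rewrite in_itv/= => /andP[at_ _].
    by rewrite derive1E; case: (dH t (lt_trans a0 at_)).
(* Starting at 2 keeps the endpoints distinct already for n = 0, as [bound] demands. *)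
pose F n := `[(n.+2%:R)^-1, n.+2%:R : R]%classic.
have FE : \bigcup_n F n = `]0%R, +oo[%classic.
  apply/seteqP; split=> t /=.
    move=> [n _]; rewrite /F/= !in_itv/= andbT => /andP[h1 _].
    by apply: lt_le_trans h1; rewrite invr_gt0.
  rewrite in_itv/= andbT => t0.
  pose n := maxn (Num.truncn t) (Num.truncn t^-1); exists n => //.
  have nt (y : R) : (Num.truncn y <= n)%N -> y <= n.+2%:R.
    move=> yn; apply: (@le_trans _ _ (Num.truncn y).+1%:R); first exact/ltW/truncnS_gt.
    by rewrite ler_nat ltnS leqW.
  rewrite /F/= in_itv/=; apply/andP; split; last by apply: nt; rewrite leq_max leqnn.
  rewrite -[t]invrK lef_pV2 ?posrE ?invr_gt0//.
  by apply: nt; rewrite leq_max leqnn orbT.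
rewrite -FE; apply: (@le_lt_trans _ _ (C / z)%:E); last exact: ltry.
have cv : (\int[mu]_(x in F i) (EFin \o f) x)%E @[i --> \oo] -->
    (\int[mu]_(x in \bigcup_i F i) (EFin \o f) x)%E.
  apply: ge0_nondecreasing_set_cvg_integral => //.
  - apply/nondecreasing_seqP => k; rewrite subsetEset => t.
    rewrite /F/= !in_itv/= => /andP[h1 h2]; apply/andP; split.
      by apply: le_trans h1; rewrite lef_pV2 ?posrE// ler_nat.
    by apply: le_trans h2 _; rewrite ler_nat.
  - by move=> i; exact: measurable_itv.
  - by move=> i; apply/measurable_EFinP; exact: measurable_funTS.
  - by move=> i t _; rewrite lee_fin.
move/cvge_to_le: cv; apply; apply: nearW => k; apply: bound; first by rewrite invr_gt0.
apply: (@lt_trans _ _ 1); last by rewrite ltr1n.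
by rewrite invf_lt1// ltr1n.
Qed.

Lemma Gamma_gt0 (z : R) : 0 < z -> 0 < Gamma z.
Proof.
move=> z0; have fin := gamma_integral_fin z0.
pose f t : R := t `^ (z - 1) * expR (- t).
have f0 t : 0 <= f t by rewrite mulr_ge0 ?powR_ge0 ?expR_ge0.
have mf : measurable_fun setT f.
  apply: measurable_funM; first exact: measurable_powR.
  by apply: measurableT_comp => //; exact: measurable_expR.
rewrite /Gamma (_ : [set t | 0 < t] = `]0, +oo[%classic); last first.
  by apply/seteqP; split=> t /=; rewrite in_itv/= andbT.
rewrite /Rintegral fine_gt0// fin andbT.
(* A lower bound of the integrand on [1, 2]: there 0 <= ln t <= 2, so t^(z-1) >= exp(-2|z-1|), and
   exp(-t) >= exp(-2). *)
pose c := expR (- (`|z - 1| * 2)) * expR (- 2) : R.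
have c0 : 0 < c by rewrite mulr_gt0 ?expR_gt0.
apply: (@lt_le_trans _ _ (\int[mu]_(t in `[1%R, 2%R]) (f t)%:E)%E); last first.
  apply: ge0_subset_integral => //.
  - by apply: (measurable_EFinP _ f).2; exact: measurable_funTS.
  - by move=> t _; rewrite lee_fin.
  - by move=> t /=; rewrite !in_itv/= => /andP[t1 _]; rewrite andbT; lra.
apply: (@lt_le_trans _ _ (\int[mu]_(t in `[1%R, 2%R]) (cst c%:E) t)%E).
  rewrite integral_cst//= lebesgue_measure_itv/= lte_fin ltr1n/= -EFinB -EFinM lte_fin.
  by rewrite mulr_gt0//; lra.
apply: ge0_le_integral => //.
- by move=> t _; rewrite lee_fin ltW.
- by apply: (measurable_EFinP _ f).2; exact: measurable_funTS.
move=> t /=; rewrite in_itv/= => /andP[t1 t2]; rewrite lee_fin /c /f.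
apply: ler_pM; rewrite ?expR_ge0//; last by rewrite ler_expR; lra.
rewrite /powR gt_eqF; last lra.
rewrite ler_expR.
have l0 : 0 <= ln t by rewrite ln_ge0.
have l2 : ln t <= 2 by apply: (le_trans (ltW (ln_sublinear _))) => //; lra.
have := ler_norm (- (z - 1)); rewrite normrN => h.
have h' : 0 <= `|z - 1| := normr_ge0 _; nra.
Qed.

Lemma cNs_gt0 (n : nat) (s : R) : 0 < s < 1 -> 0 < cNs n s.
Proof.
move=> /andP[s0 s1]; rewrite /cNs.
rewrite divr_gt0 ?Gamma_gt0//; last lra.
rewrite mulr_gt0 ?Gamma_gt0//; last first.
  by have := ler0n R n; lra.
by rewrite !mulr_gt0// powR_gt0// pi_gt0.
Qed.

End GammaPositive.

(** * The annulus weight *)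

Section AnnulusWeight.
Variable R : realType.

Definition annulus_weight n (a eps : R) (z : 'rV[R]_n) : R :=
  if (eps <= enorm n z) && (enorm n z < eps^-1) then (enorm n z `^ a)^-1 else 0.

Lemma frac_lap_truncE n (s : R) (u : 'rV[R]_n -> R) x eps :
  frac_lap_trunc n s u x eps =
  cNs n s * rint n (fun z => (u x - u (x + z)) * annulus_weight (n%:R + 2 * s) eps z).
Proof.
rewrite /frac_lap_trunc; congr (_ * rint _ _); apply/funext => z.
by rewrite /annulus_weight; case: ifP; rewrite ?mulr0.
Qed.

(** Two linear ramps of width 1/(k+1) in y = |z|^2. The inner one lies outside the annulus and the
    outer one inside it, so that the limit is right at both boundary spheres: the inner is included,
    the outer excluded. *)
Definition cutoff (eps : R) (k : nat) (y : R) : R :=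
  Num.max 0 (Num.min 1 (1 + k.+1%:R * (y - eps ^+ 2))) *
  Num.max 0 (Num.min 1 (k.+1%:R * (eps^-1 ^+ 2 - y))).

(** The power weight frozen at radius eps inside the inner ball, which makes it continuous and
    bounded without changing it on the annulus. *)
Definition profile (a eps y : R) : R := (Num.sqrt (Num.max y (eps ^+ 2)) `^ a)^-1.

Lemma cutoff_bound eps k y : 0 <= cutoff eps k y <= 1.
Proof.
have h (t : R) : 0 <= Num.max 0 (Num.min 1 t) <= 1.
  by rewrite le_max lexx ge_max ler01 ge_min lexx.
rewrite /cutoff; have /andP[h1 h2] := h (1 + k.+1%:R * (y - eps ^+ 2)).
have /andP[h3 h4] := h (k.+1%:R * (eps^-1 ^+ 2 - y)).
by rewrite mulr_ge0//= mulr_ile1.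
Qed.

Lemma profile_gt0 a eps y : 0 < eps -> 0 < profile a eps y.
Proof.
move=> e0; rewrite invr_gt0 powR_gt0// sqrtr_gt0 lt_max; apply/orP; right.
exact: exprn_gt0.
Qed.

Lemma profile_le a eps y : 0 < eps -> 0 <= a -> profile a eps y <= (eps `^ a)^-1.
Proof.
move=> e0 a0; rewrite lef_pV2 ?posrE ?powR_gt0//; last first.
  by rewrite sqrtr_gt0 lt_max exprn_gt0// orbT.
apply: ge0_ler_powR => //; rewrite ?nnegrE ?sqrtr_ge0//; first exact: ltW.
have {1}-> : eps = Num.sqrt (eps ^+ 2) by rewrite sqrtr_sqr ger0_norm// ltW.
by rewrite ler_wsqrtr// le_max lexx orbT.
Qed.

Lemma continuous_cutoff eps k : continuous (cutoff eps k).
Proof.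
have h (f : R -> R) : continuous f -> continuous (fun y => Num.max 0 (Num.min 1 (f y))).
  move=> cf; apply: continuous_max_fun; first exact: cst_continuous.
  by apply: continuous_min_fun => //; exact: cst_continuous.
have cid : continuous (fun y : R => y) by move=> y; exact: cvg_id.
apply: continuous_mul_fun; apply: h.
- apply: continuous_add_fun; first exact: cst_continuous.
  apply: continuous_mul_fun; first exact: cst_continuous.
  by move=> y; apply: cvgB; [exact: cvg_id|exact: cvg_cst].
- apply: continuous_mul_fun; first exact: cst_continuous.
  by move=> y; apply: cvgB; [exact: cvg_cst|exact: cvg_id].
Qed.

Lemma continuous_profile a eps : 0 < eps -> continuous (profile a eps).
Proof.
move=> e0 y.
have m0 : 0 < Num.sqrt (Num.max y (eps ^+ 2)).
  by rewrite sqrtr_gt0 lt_max exprn_gt0// orbT.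
apply: cvgV; first by rewrite gt_eqF// powR_gt0.
have c1 : continuous (fun y : R => Num.sqrt (Num.max y (eps ^+ 2))).
  have c0 : continuous (fun y : R => Num.max y (eps ^+ 2)).
    by apply: continuous_max_fun; [move=> t; exact: cvg_id|exact: cst_continuous].
  exact: (continuous_comp_fun c0 (@sqrt_continuous R)).
apply: (@continuous_comp _ _ _ (fun y : R => Num.sqrt (Num.max y (eps ^+ 2)))
  (fun t : R => t `^ a)); first exact: c1.
apply: differentiable_continuous; apply/derivable1_diffP.
by apply: derivable_powR; rewrite in_itv/= m0.
Qed.

Definition weight_approx (a eps : R) k y := cutoff eps k y * profile a eps y.

Lemma continuous_weight_approx a eps k : 0 < eps -> continuous (weight_approx a eps k).
Proof.
by move=> e0; apply: continuous_mul_fun; [exact: continuous_cutoff|exact: continuous_profile].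
Qed.

Lemma weight_approx_support a eps k y : eps^-1 ^+ 2 <= y -> weight_approx a eps k y = 0.
Proof.
move=> h; rewrite /weight_approx /cutoff [X in _ * X * _](_ : _ = 0) ?mulr0 ?mul0r//.
apply/max_idPl; rewrite ge_min; apply/orP; right.
by rewrite mulr_ge0_le0// subr_le0.
Qed.

Lemma weight_approx_bound a eps k y : 0 < eps -> 0 <= a ->
  `|weight_approx a eps k y| <= (eps `^ a)^-1.
Proof.
move=> e0 a0; have /andP[h1 h2] := cutoff_bound eps k y.
have p0 := profile_gt0 a y e0.
rewrite /weight_approx ger0_norm; last by rewrite mulr_ge0// ltW.
apply: (@le_trans _ _ (profile a eps y)); last exact: profile_le.
by rewrite ler_piMl// ltW.
Qed.

Lemma near_infty_ge1_mul (d : R) : 0 < d -> \forall k \near \oo, 1 <= k.+1%:R * d.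
Proof.
move=> d0; exists (Num.truncn d^-1) => // k /= hk.
rewrite -ler_pdivrMr// div1r.
apply: (@le_trans _ _ (Num.truncn d^-1).+1%:R); first exact/ltW/truncnS_gt.
by rewrite ler_nat ltnS.
Qed.

(** At each point the sequence is eventually equal to its limit, once the ramps are narrower than
    the distance to the relevant threshold. *)
Lemma weight_approx_cvg n a eps (z : 'rV[R]_n) : 0 < eps ->
  weight_approx a eps k (sqnorm z) @[k --> \oo] --> annulus_weight a eps z.
Proof.
move=> e0; set y := sqnorm z; have y0 : 0 <= y := sqnorm_ge0 z.
have nE : enorm n z = Num.sqrt y by [].
have E1 : (eps <= enorm n z) = (eps ^+ 2 <= y).
  have {1}-> : eps = Num.sqrt (eps ^+ 2) by rewrite sqrtr_sqr ger0_norm// ltW.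
  by rewrite nE ler_sqrt.
have E2 : (enorm n z < eps^-1) = (y < eps^-1 ^+ 2).
  have {1}-> : eps^-1 = Num.sqrt (eps^-1 ^+ 2).
    by rewrite sqrtr_sqr ger0_norm// invr_ge0 ltW.
  by rewrite nE ltr_sqrt// exprn_gt0// invr_gt0.
suff H : \forall k \near \oo, annulus_weight a eps z = weight_approx a eps k y.
  by apply: cvg_near_cst; apply: filterS H => k ->.
rewrite /annulus_weight E1 E2.
case: (ltP y (eps ^+ 2)) => h1 /=.
  have d0 : 0 < eps ^+ 2 - y by rewrite subr_gt0.
  apply: filterS (near_infty_ge1_mul d0) => k hk.
  rewrite /weight_approx /cutoff [X in X * _ * _](_ : _ = 0) ?mul0r//.
  apply/max_idPl; rewrite ge_min; apply/orP; right; lra.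
case: (ltP y (eps^-1 ^+ 2)) => h2 /=; last first.
  by apply: nearW => k; rewrite weight_approx_support.
have d0 : 0 < eps^-1 ^+ 2 - y by rewrite subr_gt0.
apply: filterS (near_infty_ge1_mul d0) => k hk.
rewrite /weight_approx /profile nE max_l//.
suff -> : cutoff eps k y = 1 by rewrite mul1r.
rewrite /cutoff.
have h3 : 0 <= k.+1%:R * (y - eps ^+ 2) by rewrite mulr_ge0// subr_ge0.
by rewrite !min_l ?max_r ?mulr1//; lra.
Qed.

Lemma annulus_weight_cvg n a eps (f : 'rV[R]_n -> R) : 0 < eps -> 0 <= a -> continuous f ->
  tame (fun z => f z * annulus_weight a eps z) /\
  rint n (fun z => f z * weight_approx a eps k (sqnorm z)) @[k --> \oo] -->
  rint n (fun z => f z * annulus_weight a eps z).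
Proof.
move=> e0 a0 cf; pose B := eps^-1 ^+ 2.
have B0 : 0 <= B by rewrite exprn_ge0// invr_ge0 ltW.
have B1 : 0 <= B + 1 by rewrite addr_ge0.
have [K [K0 fK]] := continuous_bounded_box (B + 1) cf.
apply: (@tame_cvg _ _ (B + 1) (K * (eps `^ a)^-1)) => //.
- move=> k; apply: continuous_mul_fun => //.
  apply: (@continuous_comp_fun _ _ _ (@sqnorm R n) (weight_approx a eps k)).
    exact: continuous_sqnorm.
  exact: continuous_weight_approx.
- move=> k z; case: (boolP (box _ z)) => bz; last first.
    by rewrite weight_approx_support ?mulr0 ?normr0//; exact: outside_box_sqnorm.
  by rewrite mulr1 normrM ler_pM//; [exact: fK|exact: weight_approx_bound].
- by move=> z; apply: cvgM; [exact: cvg_cst|exact: weight_approx_cvg].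
Qed.

(** A tent on [1, 3] scaled by the smallest value there of y^(-a/2). For eps <= 1/2 one has eps^2 <=
    1 and eps^-2 >= 4, which leaves room for the outer ramp of width at most 1: the tent lies below
    every [weight_approx], whatever eps and k. *)
Definition bump (a y : R) : R := Num.max 0 (1 - `|y - 2|) * (Num.sqrt 3 `^ a)^-1.

Lemma bump_le a eps k y : 0 < eps <= 2^-1 -> 0 <= a -> bump a y <= weight_approx a eps k y.
Proof.
move=> /andP[e0 e1] a0; have p0 := profile_gt0 a y e0.
have /andP[c0 c1] := cutoff_bound eps k y.
rewrite /bump; case: (leP (1 - `|y - 2|) 0) => h.
  by rewrite mul0r mulr_ge0// ltW.
have /andP[y1 y3] : 1 < y < 3.
  have := ler_norm (y - 2); have := ler_norm (- (y - 2)); rewrite normrN => ? ?.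
  by apply/andP; split; lra.
have e2 : eps ^+ 2 <= 1 by rewrite expr2; nra.
have e4 : 4 <= eps^-1 ^+ 2.
  have : 2 <= eps^-1 by rewrite -[2]invrK lef_pV2 ?posrE ?invr_gt0.
  by rewrite expr2 => ?; nra.
have -> : weight_approx a eps k y = profile a eps y.
  rewrite /weight_approx; suff -> : cutoff eps k y = 1 by rewrite mul1r.
  have k1 : 1 <= k.+1%:R :> R by rewrite ler1n.
  have h3 : 0 <= k.+1%:R * (y - eps ^+ 2) by rewrite mulr_ge0//; lra.
  have h4 : 1 <= k.+1%:R * (eps^-1 ^+ 2 - y) by nra.
  by rewrite /cutoff !min_l ?max_r ?mulr1//; lra.
have s3 : 0 < (Num.sqrt 3 `^ a)^-1 :> R by rewrite invr_gt0 powR_gt0// sqrtr_gt0.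
apply: (@le_trans _ _ (Num.sqrt 3 `^ a)^-1).
  by apply: (ler_piMl (ltW s3)); have := normr_ge0 (y - 2); lra.
rewrite /profile max_l; last lra.
rewrite lef_pV2 ?posrE ?powR_gt0 ?sqrtr_gt0//; last lra.
by apply: ge0_ler_powR => //; rewrite ?nnegrE ?sqrtr_ge0// ler_sqrt//; lra.
Qed.

(** K is a quarter of the integral of -G0, for G0 the primitive of [bump], and so is independent of
    eps. Since [bump] lies below the approximate weights, their primitives satisfy -G >= -G0; the
    bound then passes to the limit in k. *)
Lemma annulus_second_coef_lower n (a : R) : 0 <= a -> exists K : R, 0 < K /\
  forall (p : 'rV[R]_n -> R) x (P : 'rV[R]_n -> {poly R}) d, polyfun p ->
  (forall z t, (P z).[t] = p (x + t *: z)) -> (forall k, continuous (fun z => (P z)`_k)) ->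
  (forall z, (size (P z) <= d)%N) ->
  forall eps, 0 < eps <= 2^-1 ->
  `|laplacian p x| * K <= `|rint n (fun z => (P z)`_2 * annulus_weight a eps z)|.
Proof.
move=> a0.
have s3 : 0 < (Num.sqrt 3 `^ a)^-1 :> R by rewrite invr_gt0 powR_gt0// sqrtr_gt0.
have cb : continuous (bump a).
  apply: continuous_mul_fun; last exact: cst_continuous.
  apply: continuous_max_fun; first exact: cst_continuous.
  move=> y; apply: cvgB; first exact: cvg_cst.
  by apply: cvg_norm; apply: cvgB; [exact: cvg_id|exact: cvg_cst].
have b3 y : 3 <= y -> bump a y = 0.
  move=> y3; rewrite /bump max_l ?mul0r// ger0_norm; lra.
have [G0 pG0] := radial_primitive_exists (ler0n R 3) cb b3.
have b0 y : 0 <= bump a y by apply: mulr_ge0; [rewrite le_max lexx|exact: ltW].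
have G00 : G0 0 < 0.
  apply: (radial_primitive_lt0 (a := 1) (b := 3) pG0) => //; first lra.
  move=> y /andP[y1 y3]; rewrite mulr_gt0// lt_max; apply/orP; right.
  by rewrite subr_gt0 ltr_norml; apply/andP; split; lra.
have tG B g G : radial_primitive B g G ->
    [/\ continuous (fun z : 'rV[R]_n => - G (sqnorm z)) &
        compactly_dominated (fun z : 'rV[R]_n => - G (sqnorm z))].
  move=> pG; have [B0 _ _ supp] := pG.
  have c : continuous (fun z : 'rV[R]_n => - G (sqnorm z)).
    by apply: continuous_opp_fun; exact: continuous_primitive pG.
  have B1 : 0 <= B + 1 by lra.
  split=> //; apply: (compactly_dominated_support B1) => // z.
  by move=> /(outside_box_sqnorm B0)/supp[_ ->]; rewrite oppr0.
have [c0 d0] := tG _ _ _ pG0.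
pose K := rint n (fun z : 'rV[R]_n => - G0 (sqnorm z)).
have Z0 : radial_primitive 0 (fun=> 0 : R) (fun=> 0 : R).
  split=> //; first exact: cst_continuous.
  by move=> x _; exact: is_derive_cst.
have K0 : 0 < K.
  apply: (@rint_gt0 _ _ _ 0) => // [z|].
    rewrite oppr_ge0.
    exact: (radial_primitive_le Z0 pG0 (fun y _ => b0 y) (sqnorm_ge0 z)).
  rewrite /sqnorm big1 ?oppr_gt0// => i _.
  by rewrite mxE expr0n.
exists (K / 4); split=> [|p x P d pp P1 P2 P3 eps eps2]; first by rewrite divr_gt0.
have /andP[e0 e1] := eps2.
have [_ cv] := annulus_weight_cvg e0 a0 (P2 2).
apply: (cvgr_to_ge (cvg_norm cv)); apply: nearW => k.
have B0 : 0 <= eps^-1 ^+ 2 by rewrite exprn_ge0// invr_ge0 ltW.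
have [G pG] := radial_primitive_exists B0 (@continuous_weight_approx a eps k e0)
  (@weight_approx_support a eps k).
rewrite (second_coef_radial_mean pG pp P1 P2 P3) normrM ler_wpM2l//.
apply: (le_trans _ (ler_norm _)); rewrite ler_pM2r//.
have [c1 d1] := tG _ _ _ pG.
apply: tame_le; [exact: tame_continuous|exact: tame_continuous|move=> z].
rewrite lerN2.
exact: (radial_primitive_le pG0 pG (fun y _ => bump_le k y eps2 a0) (sqnorm_ge0 z)).
Qed.

Lemma cvg_sumr T (F : set_system T) (FF : Filter F) I (r : seq I) (f : I -> T -> R) (l : I -> R) :
  (forall i, f i e @[e --> F] --> l i) ->
  \sum_(i <- r) f i e @[e --> F] --> \sum_(i <- r) l i.
Proof.
move=> fl; elim: r => [|i r IH].
  rewrite big_nil; under eq_fun do rewrite big_nil; exact: cvg_cst.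
rewrite big_cons; under eq_fun do rewrite big_cons.
exact: cvgD.
Qed.

(** Writing S(m) for the sum, S(2m) - 2^d S(m) has no term of degree d and multiplies each lower
    coefficient by the nonzero number 2^k - 2^d. Induction handles these coefficients, and the top
    one is S(1) minus the others. *)
Lemma cvg_poly_coef (F : set_system R) (FF : Filter F) d (c : nat -> R -> R) :
  (forall m : R, 0 < m -> \sum_(k < d) m ^+ k * c k e @[e --> F] --> 0) ->
  forall k, (k < d)%N -> c k e @[e --> F] --> 0.
Proof.
elim: d c => // d IH c h.
have H k : (k < d)%N -> c k e @[e --> F] --> 0.
  move=> kd.
  have q0 : (2 ^+ k - 2 ^+ d : R) != 0.
    rewrite lt_eqF// subr_lt0 -!natrX ltr_nat ltn_exp2l//.
  have := IH (fun k e => (2 ^+ k - 2 ^+ d) * c k e) _ k kd.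
  have E m e : \sum_(k < d) m ^+ k * ((2 ^+ k - 2 ^+ d) * c k e) =
      \sum_(k < d.+1) (2 * m) ^+ k * c k e - 2 ^+ d * \sum_(k < d.+1) m ^+ k * c k e.
    rewrite !big_ord_recr/= exprMn mulrDr opprD addrACA !mulrA subrr addr0.
    rewrite mulr_sumr -sumrB; apply: eq_bigr => i _.
    by rewrite exprMn; ring.
  move=> h1; have {}h1 : (2 ^+ k - 2 ^+ d) * c k e @[e --> F] --> 0.
    apply: h1 => m m0; under eq_fun do rewrite E.
    have h2 : \sum_(k < d.+1) (2 * m) ^+ k * c k e @[e --> F] --> 0.
      by apply: h; rewrite mulr_gt0.
    have := (cvgB h2 (cvgM (cvg_cst (2 ^+ d : R)) (h m m0))); rewrite mulr0 subr0; exact.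
  have -> : (fun e => c k e) = (fun e => (2 ^+ k - 2 ^+ d)^-1 * ((2 ^+ k - 2 ^+ d) * c k e)).
    by apply/funext => e; rewrite mulrA mulVf// mul1r.
  have := (cvgM (cvg_cst ((2 ^+ k - 2 ^+ d)^-1 : R)) h1); rewrite mulr0; exact.
move=> k; rewrite ltnS leq_eqVlt => /orP[/eqP ->|]; last exact: H.
have -> : (fun e => c d e) = (fun e => \sum_(k < d.+1) 1 ^+ k * c k e - \sum_(k < d) c k e).
  apply/funext => e; rewrite big_ord_recr/= expr1n mul1r addrAC.
  by under eq_bigr do rewrite expr1n mul1r; rewrite subrr add0r.
have hs := @cvg_sumr _ F FF _ (index_enum 'I_d) (fun (k : 'I_d) e => c k e) (fun=> 0)
  (fun k => H k (ltn_ord k)).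
have := (cvgB (h 1 ltr01) hs); rewrite big1// subr0; exact.
Qed.

Lemma tame_annulus_weight n a eps (f : 'rV[R]_n -> R) : 0 < eps -> 0 <= a -> continuous f ->
  tame (fun z => f z * annulus_weight a eps z).
Proof. by move=> e0 a0 /(annulus_weight_cvg e0 a0)[]. Qed.

Lemma harmonic_frac_lap_trunc n s (u : 'rV[R]_n -> R) x eps : 0 < eps -> 0 <= s ->
  twice_smooth u -> (forall y, laplacian u y = 0) -> frac_lap_trunc n s u x eps = 0.
Proof.
move=> e0 s0 su lu; rewrite frac_lap_truncE; set a := n%:R + 2 * s.
have a0 : 0 <= a by rewrite addr_ge0// mulr_ge0.
have [du _ _] := su.
have cu : continuous (fun z => u x - u (x + z)).
  apply: continuous_add_fun; first exact: cst_continuous.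
  apply: continuous_opp_fun; apply: (@continuous_comp_fun _ _ _ (fun z => x + z) u).
    by apply: continuous_add_fun; [exact: cst_continuous|move=> z; exact: cvg_id].
  by move=> y; exact: differentiable_continuous.
have [_ cv] := annulus_weight_cvg e0 a0 cu.
suff -> : rint n (fun z => (u x - u (x + z)) * annulus_weight a eps z) = 0 by rewrite mulr0.
apply: (cvg_unique _ cv); first exact: norm_hausdorff.
have B0 : 0 <= eps^-1 ^+ 2 by rewrite exprn_ge0// invr_ge0 ltW.
have E k : rint n (fun z => (u x - u (x + z)) * weight_approx a eps k (sqnorm z)) = 0.
  have [G pG] := radial_primitive_exists B0 (@continuous_weight_approx a eps k e0)
    (@weight_approx_support a eps k).
  exact: harmonic_radial_mean pG su lu.
by apply: cvg_near_cst; apply: nearW => k; exact: E.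
Qed.

(* Scaling [x] instead of [z] leaves the weight unchanged, so no change of variables is needed. *)
Lemma s_harmonic_poly_laplacian n k s (p : 'rV[R]_n -> R) : 0 < s < 1 -> hom_poly n k p ->
  (forall x, frac_lap_trunc n s p x eps @[eps --> 0^'+] --> 0) ->
  forall x, laplacian p x = 0.
Proof.
move=> s01 /hom_poly_polyfun[pp ph] hp x; have /andP[s0 s1] := s01.
set a := n%:R + 2 * s.
have a0 : 0 <= a by rewrite addr_ge0// mulr_ge0// ltW.
have [P [d [P1 P2 P3]]] := polyfun_line x pp.
have tP j eps : 0 < eps -> tame (fun z => (P z)`_j * annulus_weight a eps z).
  by move=> e0; exact: tame_annulus_weight.
have P0 z : (P z)`_0 = p x by rewrite -horner_coef0 P1 scale0r addr0.
(* The constant term p(x) cancels in the difference p(x) - p(x + m z). *)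
pose c j eps := if j == 0%N then 0 else cNs n s * rint n (fun z => (P z)`_j * annulus_weight a eps z).
have ctr (m : R) : 0 < m -> \sum_(j < d) m ^+ j * c j eps @[eps --> 0^'+] --> 0.
  move=> m0; have := hp (m^-1 *: x).
  have E eps : 0 < eps -> \sum_(j < d) m ^+ j * c j eps =
      - m ^+ k * frac_lap_trunc n s p (m^-1 *: x) eps.
    move=> e0; rewrite frac_lap_truncE -/a.
    (* By homogeneity the difference at x/m equals m^-k (p(x) - p(x + m z)). *)
    have pE z : p (m^-1 *: x) - p (m^-1 *: x + z) =
        - m^-1 ^+ k * \sum_(j < d) (if val j == 0%N then 0 else m ^+ j * (P z)`_j).
      have -> : m^-1 *: x + z = m^-1 *: (x + m *: z).
        by rewrite scalerDr scalerA mulVf ?gt_eqF// scale1r.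
      rewrite !ph -mulrBr mulNr -mulrN; congr (_ * _).
      rewrite -(P0 z) -P1 (horner_coef_wide _ (P3 z)).
      case: d P3 => [|d'] P3.
        by rewrite !big_ord0 subr0 oppr0 nth_default//; exact: P3.
      rewrite !big_ord_recl/= expr0 mulr1 add0r opprD addNKr.
      by congr (- _); apply: eq_bigr => j _; rewrite mulrC.
    have tj (j : 'I_d) : tame (fun z => (if val j == 0%N then 0 else m ^+ j) *
        ((P z)`_j * annulus_weight a eps z)) /\
      rint n (fun z => (if val j == 0%N then 0 else m ^+ j) *
        ((P z)`_j * annulus_weight a eps z)) =
      (if val j == 0%N then 0 else m ^+ j) * rint n (fun z => (P z)`_j * annulus_weight a eps z).
      exact: tameZ (tP j eps e0).
    have [ts rs] := tame_sum (index_enum 'I_d) (fun j => (tj j).1).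
    have [_ rz] := tameZ (- m^-1 ^+ k) ts.
    rewrite rs in rz.
    transitivity (cNs n s * \sum_(j < d) (if val j == 0%N then 0 else m ^+ j) *
        rint n (fun z => (P z)`_j * annulus_weight a eps z)).
      rewrite mulr_sumr; apply: eq_bigr => j _; rewrite /c.
      by case: eqP => _; [rewrite mulr0 mul0r mulr0|rewrite mulrCA].
    rewrite mulrCA; congr (_ * _).
    under [in LHS]eq_bigr do rewrite -(tj _).2.
    have -> : rint n (fun z => (p (m^-1 *: x) - p (m^-1 *: x + z)) * annulus_weight a eps z) =
      rint n (fun z => - m^-1 ^+ k * \sum_(j < d) (if val j == 0%N then 0 else m ^+ j) *
        ((P z)`_j * annulus_weight a eps z)).
      congr rint; apply/funext => z; rewrite pE -!mulrA; congr (_ * _).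
      rewrite mulr_suml; apply: eq_bigr => j _.
      by case: eqP => _; rewrite ?mul0r// mulrA.
    rewrite rz mulrA mulrNN -exprMn divff ?gt_eqF// expr1n mul1r.
    by [].
  move=> h; have : - m ^+ k * frac_lap_trunc n s p (m^-1 *: x) eps @[eps --> 0^'+] --> 0.
    have := (cvgM (cvg_cst (- m ^+ k)) h); rewrite mulr0; exact.
  apply: cvg_trans; apply: near_eq_cvg.
  by apply: filterS (nbhs_right_gt (0 : R)) => eps e0; rewrite E.
have [K [K0 hK]] := annulus_second_coef_lower n a0.
have cN := cNs_gt0 n s01.
have c2 : c 2 eps @[eps --> 0^'+] --> 0.
  (* If d <= 2, every P z has zero coefficient of degree 2. *)
  case: (ltnP 2 d) => d2; first exact: (@cvg_poly_coef _ _ d c ctr 2 d2).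
  rewrite /c/=; have E eps : rint n (fun z => (P z)`_2 * annulus_weight a eps z) = 0.
    rewrite -[RHS](tame0 R n).2; congr rint; apply/funext => z.
    by rewrite nth_default ?mul0r// (leq_trans (P3 z)).
  by under eq_fun do rewrite E mulr0; exact: cvg_cst.
have low : cNs n s * (`|laplacian p x| * K) <= 0.
  rewrite -[leRHS](@normr0 _ R).
  apply: (cvgr_to_ge (cvg_norm c2)); near=> eps.
  rewrite /c/= normrM (gtr0_norm cN) ler_pM2l//.
  apply: (hK p x P d) => //; apply/andP; split; near: eps; first exact: nbhs_right_gt.
  by apply: nbhs_right_le; rewrite invr_gt0.
apply/eqP; rewrite -normr_le0.
by move: low; rewrite pmulr_rle0// pmulr_lle0.
Unshelve. all: by end_near. Qed.

End AnnulusWeight.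

Theorem theorem1p1 (R : realType) (N : nat) (s : R) :
  (2 <= N)%N -> 0 < s <= 1 ->
  (forall m : nat, Hsm N s m = Hsm N 1 m) /\ (Hs N 1 `<=` Hs N s).
Proof.
move=> _ /andP[s0 s1].
have [s_lt1|] := boolP (s < 1); last first.
  rewrite -leNgt => s_ge1; have -> : s = 1 by apply/eqP; rewrite eq_le s1 s_ge1.
  by split.
have h1 (u : 'rV[R]_N -> R) : s_harmonic N 1 u = Defs.harmonic N u by rewrite /s_harmonic ltxx.
have hs (u : 'rV[R]_N -> R) : Defs.harmonic N u -> s_harmonic N s u.
  move=> [du [ddu [cddu lu]]]; rewrite /s_harmonic s_lt1; split=> [y|x].
    exact: differentiable_continuous.
  apply: cvg_near_cst; apply: filterS (nbhs_right_gt (0 : R)) => eps e0.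
  by rewrite harmonic_frac_lap_trunc// ltW.
split=> [m|u hu]; last by apply: hs; rewrite -h1; exact: hu.
apply/seteqP; split=> u [um hu]; split=> //; last by apply: hs; rewrite -h1; exact: hu.
have [pu _] := hom_poly_polyfun um.
(* [harmonic] also asks for continuous mixed second partials, which a polynomial has. *)
have [[du ddu _] cddu] := polyfun_twice_smooth pu.
move: hu; rewrite /= /s_harmonic s_lt1 => -[_ hu].
suff H : Defs.harmonic N u by rewrite -h1 in H; exact: H.
split=> //; split=> //; split=> //.
by apply: (s_harmonic_poly_laplacian _ um hu); rewrite s0 s_lt1.
Unshelve. all: by end_near. Qed.
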